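(* Let $p,q\in[1,\infty]$, $s\in\{0,1,2,\dots\}$, $\alpha\in\mathbb{R}$, and let $\mathcal{X}$ be either $\mathbb{R}^n$ or a cube $Q_0$ of $\mathbb{R}^n$. Then $f\in\widetilde{JN}_{(p,q,s)_\alpha}(\mathcal{X})$ if and only if $f\in JN_{(p,q,s)_\alpha}(\mathcal{X})$ and $f^-\in RM_{p,1,\alpha}(\mathcal{X})$. Moreover, there exist positive constants $c_1,c_2$, depending only on $s$ and $n$, such that, for any $f\in L^q_{\mathrm{loc}}(\mathcal{X})$, $$c_1\left[\|f\|_{JN_{(p,q,s)_\alpha}(\mathcal{X})}+\|f^-\|_{RM_{p,1,\alpha}(\mathcal{X})}\right]\le \|f\|_{\widetilde{JN}_{(p,q,s)_\alpha}(\mathcal{X})}\le c_2\left[\|f\|_{JN_{(p,q,s)_\alpha}(\mathcal{X})}+\|f^-\|_{RM_{p,1,\alpha}(\mathcal{X})}\right].$$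
   Context: A cube in $\mathbb{R}^n$ has finite positive edge length and edges parallel to the coordinate axes; it need not be open or closed. $\mathcal{X}$ denotes either $\mathbb{R}^n$ or a fixed cube $Q_0$ of $\mathbb{R}^n$. Functions are real-valued and $f^-:=-\min\{f,0\}$. For a cube $Q$, $⨍_Q f:=\frac1{|Q|}\int_Q f$, written $\fint_Q f$. $L^q_{\mathrm{loc}}(\mathcal{X})$ is the set of measurable $f$ on $\mathcal{X}$ with $f\mathbf 1_E\in L^q(\mathcal{X})$ for every bounded $E\subset\mathcal{X}$. When $q=\infty$, $[\fint_Q|g|^q]^{1/q}$ means the essential supremum of $|g|$ on $Q$. For $s\in\{0,1,2,\dots\}$, a cube $Q$ and $f$ integrable on $Q$, $P^{(s)}_Q(f)$ is the unique polynomial of degree at most $s$ such that $\int_Q[f(x)-P^{(s)}_Q(f)(x)]x^\gamma\,dx=0$ for every multi-index $\gamma$ with $|\gamma|\le s$. For $g=(g_Q)_Q$ a family of nonnegative numbers (possibly $\infty$) indexed by cubes $Q\subset\mathcal{X}$, set $N_{p,\alpha}(g):=\sup\{\sum_i|Q_i|[|Q_i|^{-\alpha}g_{Q_i}]^p\}^{1/p}$ if $p\in[1,\infty)$, the supremum being over all collections $\{Q_i\}_i$ of cubes contained in $\mathcal{X}$ with pairwise disjoint interiors, and $N_{\infty,\alpha}(g):=\sup_{Q\subset\mathcal{X}}|Q|^{-\alpha}g_Q$ (supremum over all cubes $Q\subset\mathcal{X}$). For $f\in L^q_{\mathrm{loc}}(\mathcal{X})$: - $\|f\|_{JN_{(p,q,s)_\alpha}(\mathcal{X})}:=N_{p,\alpha}(g)$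 with $g_Q=[\fint_Q|f-P^{(s)}_Q(f)|^q]^{1/q}$; - $\|f\|_{\widetilde{JN}_{(p,q,s)_\alpha}(\mathcal{X})}:=N_{p,\alpha}(g)$ with $g_Q=[\fint_Q|f-P^{(s)}_Q(|f|)|^q]^{1/q}$; - $\|f\|_{RM_{p,q,\alpha}(\mathcal{X})}:=N_{p,\alpha}(g)$ with $g_Q=[\fint_Q|f|^q]^{1/q}$. Each space consists of those $f\in L^q_{\mathrm{loc}}(\mathcal{X})$ for which the corresponding quantity is finite (with $q=1$ in the case of $RM_{p,1,\alpha}$). *)

(* Defs.v *)
From HB Require Import structures.
From mathcomp Require Import all_boot all_order all_algebra.
(* The notations of mpoly clash with those of MathComp-Analysis. *)
From mathcomp Require Import -(notations) mpoly.
From mathcomp Require Import all_classical all_reals all_analysis.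
From mathcomp Require Import ess_sup_inf.

Set Implicit Arguments.
Unset Strict Implicit.
Unset Printing Implicit Defensive.
Import Order.TTheory GRing.Theory Num.Theory.
Import numFieldNormedType.Exports.
Local Open Scope classical_set_scope.
Local Open Scope ring_scope.

(* Euclidean space of dimension n.+1, so that the dimension is positive. *)
Definition euclid (R : realType) (n : nat) : Type := 'rV[R]_n.+1.

HB.instance Definition _ (R : realType) (n : nat) :=
  NormedModule.copy (euclid R n) 'rV[R]_n.+1.

(* A pair (a, b) codes the half-open box prod_i ]a_i, b_i], which is empty,
   with volume 0, as soon as b_i <= a_i for some i. *)
Definition box (R : realType) (n : nat) (B : euclid R n * euclid R n) :
    set (euclid R n) :=
  [set x | forall i, B.1 ord0 i < x ord0 i <= B.2 ord0 i].

Definition box_volume (R : realType) (n : nat) (B : euclid R n * euclid R n) :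
    \bar R :=
  (\prod_(i < n.+1) Num.max 0 (B.2 ord0 i - B.1 ord0 i))%:E.

Definition lebesgue_outer (R : realType) (n : nat) (A : set (euclid R n)) :
    \bar R :=
  ereal_inf [set (\sum_(k <oo) box_volume (F k))%E |
    F in [set F : nat -> euclid R n * euclid R n |
           A `<=` \bigcup_k box (F k)]].

Section lebesgue_outer_measure.
Context (R : realType) (n : nat).
Implicit Types A B : set (euclid R n).
Local Open Scope ereal_scope.

Lemma box_volume_ge0 (B : euclid R n * euclid R n) : 0 <= box_volume B.
Proof. by rewrite lee_fin; apply: prodr_ge0 => i _; rewrite le_max lexx. Qed.

Lemma lebesgue_outer_ge0 A : 0 <= lebesgue_outer A.
Proof.
apply: le_ereal_inf_tmp => _ [F _ <-].
by apply: nneseries_ge0 => k _ _; exact: box_volume_ge0.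
Qed.

Lemma lebesgue_outer_le :
  {homo @lebesgue_outer R n : A B / A `<=` B >-> A <= B}.
Proof.
move=> A B AB; apply/ereal_inf_le_tmp => _ [F BF <-].
by exists F => //; exact: subset_trans BF.
Qed.

Lemma lebesgue_outer0 : lebesgue_outer (@set0 (euclid R n)) = 0.
Proof.
apply/eqP; rewrite eq_le lebesgue_outer_ge0 andbT.
apply: ereal_inf_lbound; exists (fun=> (0%R, 0%R)); first exact: sub0set.
apply: eseries0 => k _ _.
by rewrite /box_volume big_ord_recl subrr maxxx mul0r.
Qed.

Lemma lebesgue_outer_sigma_subadditive :
  sigma_subadditive (@lebesgue_outer R n).
Proof.
move=> A; have [[i ioo]|] := pselect (exists i, lebesgue_outer (A i) = +oo).
  rewrite (eseries_pinfty _ _ ioo) ?leey// => k _.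
  by rewrite -ltNye (lt_le_trans _ (lebesgue_outer_ge0 _)).
rewrite -forallNE => Aoo; apply/lee_addgt0Pr => e e0.
rewrite (le_trans _ (epsilon_trick _ _ (ltW e0)))//; last first.
  by move=> k; exact: lebesgue_outer_ge0.
pose P k (F : nat -> euclid R n * euclid R n) :=
  A k `<=` \bigcup_j box (F j) /\
  \sum_(j <oo) box_volume (F j)
    <= lebesgue_outer (A k) + (e / (2 ^ k.+1)%:R)%:E.
have [G PG] : {G : nat -> nat -> euclid R n * euclid R n & forall k, P k (G k)}.
  apply: (@choice _ _ P) => k.
  have fink : lebesgue_outer (A k) \is a fin_num.
    by rewrite ge0_fin_numE ?lebesgue_outer_ge0// ltey; exact/eqP/Aoo.
  have ek : (0 < e / (2 ^ k.+1)%:R)%R by rewrite divr_gt0// ltr0n expn_gt0.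
  have [_ [F AF <-] Fe] := lb_ereal_inf_adherent ek fink.
  by exists F; split => //; exact: ltW.
apply: (@le_trans _ _ (\esum_(k in setT) box_volume (G k.1 k.2))).
  have /card_esym/ppcard_eqP[f] := card_nat2.
  apply: ereal_inf_lbound; exists (fun j => G (f j).1 (f j).2).
    move=> t [k _ /(PG k).1 [j _ Gt]].
    by exists (f^-1%FUN (k, j)) => //=; rewrite invK ?inE.
  rewrite nneseries_esumT => [|j]; last exact: box_volume_ge0.
  by rewrite [RHS](reindex_esum [set: nat] _ f).
apply: (@le_trans _ _ (\sum_(i <oo) \sum_(j <oo) box_volume (G i j))).
  rewrite nneseries_esumT => [|k]; last first.
    by apply: nneseries_ge0 => j _ _; exact: box_volume_ge0.
  rewrite (eq_esum (b := fun i => \esum_(j in setT) box_volume (G i j))).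
    rewrite esum_esum => [|*]; last exact: box_volume_ge0.
    by rewrite (_ : _ `*`` _ = setT)//; apply/seteqP; split.
  by move=> k _; apply: nneseries_esumT => j; exact: box_volume_ge0.
apply: lee_nneseries => k _; last exact: (PG k).2.
by move=> _; apply: nneseries_ge0 => j _ _; exact: box_volume_ge0.
Qed.

HB.instance Definition _ := isOuterMeasure.Build R (euclid R n)
  (@lebesgue_outer R n) lebesgue_outer0 lebesgue_outer_ge0 lebesgue_outer_le
  lebesgue_outer_sigma_subadditive.

(* By Caratheodory's construction, measurable means Lebesgue measurable, not
   only Borel. *)
HB.instance Definition _ := Measurable.copy (euclid R n)
  (caratheodory_type (@lebesgue_outer R n)).

Definition lebesgue : set (euclid R n) -> \bar R := @lebesgue_outer R n.

HB.instance Definition _ := isMeasure.Build _ _ R lebesgue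
  (@caratheodory_measure0 R _ (@lebesgue_outer R n))
  (@caratheodory_measure_ge0 R _ (@lebesgue_outer R n))
  (@caratheodory_measure_sigma_additive R _ (@lebesgue_outer R n)).

End lebesgue_outer_measure.

Section spaces.
Context (R : realType) (n : nat).
Implicit Types (Q X : set (euclid R n)) (f h : euclid R n -> R).
Implicit Types (p q : \bar R) (alpha : R) (s : nat).

(* Each side of a cube may independently contain or omit its endpoints. *)
Definition cube Q := exists (a : euclid R n) (l : R) (b c : 'I_n.+1 -> bool),
  0 < l /\
  Q = [set x | forall i, x ord0 i \in
        Interval (BSide (b i) (a ord0 i)) (BSide (c i) (a ord0 i + l))].

(* Functions on X are total functions of which only the values on X matter. The
   sets E are measurable, as f 1_E cannot be in L^q for every bounded E. *)
Definition Lqloc q X : set (euclid R n -> R) :=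
  [set f : euclid R n -> R | measurable_fun X f /\
    forall E : set (euclid R n), measurable E -> bounded_set E -> E `<=` X ->
      finite_norm (@lebesgue R n) q (fun x => f x * \1_E x)].

Definition monomial (g : multinom n.+1) (x : euclid R n) : R :=
  \prod_(i < n.+1) x ord0 i ^+ g i.

Definition polyeval (P : mpoly n.+1 R) (x : euclid R n) : R :=
  meval (x ord0) P.

(* msize is the total degree plus one, and mdeg g is |g|. *)
Definition is_polyproj s Q f (P : mpoly n.+1 R) :=
  (msize P <= s.+1)%N /\
  forall g : multinom n.+1, (mdeg g <= s)%N ->
    \int[@lebesgue R n]_(x in Q) ((f x - polyeval P x) * monomial g x) = 0.

Definition polyproj s Q f : mpoly n.+1 R := xget 0 (is_polyproj s Q f).

Local Open Scope ereal_scope.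

(* The cases q = -oo here and p = -oo in Nnorm are junk. For q = +oo, the extension by 0 outside Q does not change the
   essential supremum, since the function is nonnegative. *)
Definition qmean q Q h : \bar R :=
  match q with
  | q%:E => poweR ((fine (lebesgue Q))^-1%:E *
      \int[@lebesgue R n]_(x in Q) (`|h x| `^ q)%:E) q^-1
  | +oo => ess_sup (@lebesgue R n) (fun x => (`|h x| * \1_Q x)%:E)
  | -oo => 0
  end.

(* Collections of cubes are sets of cubes: cubes with disjoint interiors are
   pairwise distinct. *)
Definition collection X (C : set (set (euclid R n))) :=
  (forall Q, C Q -> cube Q /\ Q `<=` X) /\ trivIset C interior.

Definition Nnorm p alpha X (g : set (euclid R n) -> \bar R) : \bar R :=
  match p with
  | p%:E => poweR (ereal_sup
      [set \esum_(Q in C) (lebesgue Q *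
              poweR (poweR (lebesgue Q) (- alpha) * g Q) p)
      | C in collection X]) p^-1
  | +oo => ereal_sup [set poweR (lebesgue Q) (- alpha) * g Q
      | Q in [set Q | cube Q /\ Q `<=` X]]
  | -oo => 0
  end.

Definition JNnorm p q s alpha X f : \bar R :=
  Nnorm p alpha X
    (fun Q => qmean q Q (fun x => f x - polyeval (polyproj s Q f) x)%R).

Definition tJNnorm p q s alpha X f : \bar R :=
  Nnorm p alpha X
    (fun Q => qmean q Q
      (fun x => f x - polyeval (polyproj s Q (fun y => `|f y|%R)) x)%R).

Definition RMnorm p q alpha X f : \bar R :=
  Nnorm p alpha X (fun Q => qmean q Q f).

Definition JN p q s alpha X : set (euclid R n -> R) :=
  [set f | Lqloc q X f /\ JNnorm p q s alpha X f < +oo].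

Definition tJN p q s alpha X : set (euclid R n -> R) :=
  [set f | Lqloc q X f /\ tJNnorm p q s alpha X f < +oo].

Definition RM p q alpha X : set (euclid R n -> R) :=
  [set f | Lqloc q X f /\ RMnorm p q alpha X f < +oo].

End spaces.

(* Main.v *)
Require Import Defs.
From mathcomp Require Import all_boot all_order all_algebra.
(* The notations of mpoly clash with those of MathComp-Analysis. *)
From mathcomp Require Import -(notations) mpoly.
From mathcomp Require Import all_classical all_reals all_analysis.
From mathcomp Require Import measurable_realfun ess_sup_inf.
From mathcomp Require Import ring lra.

(* Since |f| - f = 2 f^- on every cube Q, linearity of the projection P_Q turns
   everything into three estimates on a single cube, with constants depending
   only on s and n:
   - P_Q(|f|) - P_Q(f) is the projection of 2 f^-, hence is bounded on Q by a
     multiple of the mean of f^-;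
   - P_Q(f) - P_Q(|f|) is the projection of f - P_Q(|f|), hence is bounded on Q
     by a multiple of the q-mean of f - P_Q(|f|);
   - the integral of 2 f^- = |f| - f over Q equals that of P_Q(|f|) - f.
   The bound of P_Q(h) on Q by the mean of |h| is obtained on the unit cube by
   inverting the Gram matrix of the monomials, and carried over to Q by an
   affine change of variables. Triangle inequalities are only needed up to a
   numerical factor, through (x + y)^r <= 2^r (x^r + y^r). *)

Set Implicit Arguments.
Unset Strict Implicit.
Unset Printing Implicit Defensive.
Import Order.TTheory GRing.Theory Num.Theory.
Import numFieldNormedType.Exports.
Local Open Scope classical_set_scope.
Local Open Scope ring_scope.

(** * Lebesgue measure of boxes *)

(** The measure is given only as an infimum over countable box coverings, so every fact about cubes
    has to be drawn from coverings. The decisive one is that cubes have positive measure, since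
    otherwise the Gram matrix could vanish. It follows from the unit box having measure 1 and from
    the scaling of the outer measure under [x ↦ a + l x]. A cube may contain or omit each of its
    faces, so affine maps lead not to one unit cube but to one for each of finitely many endpoint
    patterns. The projection bound is proved for each pattern and the constants are added, so that
    they depend on [n] and [s] only. A vector in the kernel of the Gram matrix gives a polynomial
    whose square has integral 0; it vanishes on the open unit cube, hence has zero coefficients.
    [polyproj] is a choice among the polynomials satisfying [is_polyproj], so the bound is shown for
    every such polynomial, together with existence. The comparison of the mean with the [q]-mean
    rests on an elementary pointwise inequality instead of Hölder's. It costs a factor 2, which
    cancels against the 2 in [2 f^-]. *)

Section measure_of_boxes.
Context (R : realType) (n : nat).
Implicit Types (a x : euclid R n) (B : euclid R n * euclid R n).
Notation mu := (@lebesgue R n).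
Notation outer := (@lebesgue_outer R n).

(** The hyperplane cuts each box of a covering of the test set into two boxes whose volumes add up.
    Boxes are open below and closed above, so both pieces are again boxes of this form. *)
Lemma caratheodory_halfspace (i : 'I_n.+1) (c : R) :
  measurable [set x : euclid R n | x ord0 i <= c].
Proof.
apply: le_caratheodory_measurable => X.
apply: le_ereal_inf_tmp => _ [F XF <-].
(* If [c] lies outside the side of [B] in direction [i], one of [lo B], [hi B] is [B] and the other
   has reversed or equal endpoints, hence volume 0. *)
pose lo (B : euclid R n * euclid R n) : euclid R n * euclid R n :=
  (B.1, \row_j if j == i then Num.min (B.2 ord0 j) c else B.2 ord0 j).
pose hi (B : euclid R n * euclid R n) : euclid R n * euclid R n :=
  (\row_j (if j == i then Num.max (B.1 ord0 j) c else B.1 ord0 j), B.2).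
have vol B : box_volume B = (box_volume (lo B) + box_volume (hi B))%E.
  have volE C : box_volume C = (Num.max 0 (C.2 ord0 i - C.1 ord0 i) *
      \prod_(j | j != i) Num.max 0 (C.2 ord0 j - C.1 ord0 j))%:E.
    by rewrite /box_volume (bigD1 i).
  rewrite !volE -EFinD /= !mxE eqxx.
  rewrite [in X in _ = (X + _)%:E](eq_bigr (fun j =>
    Num.max 0 (B.2 ord0 j - B.1 ord0 j))); last first.
    by move=> j /negbTE ji; rewrite mxE ji.
  rewrite [in X in _ = (_ + X)%:E](eq_bigr (fun j =>
    Num.max 0 (B.2 ord0 j - B.1 ord0 j))); last first.
    by move=> j /negbTE ji; rewrite mxE ji.
  rewrite -mulrDl; congr ((_ * _)%:E).
  set u := B.1 ord0 i; set v := B.2 ord0 i.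
  rewrite /Num.max /Num.min; do !case: ifPn; rewrite -?leNgt; lra.
rewrite (eq_eseriesr (fun k _ => vol (F k))) nneseriesD; [|by move=> *;
  exact: box_volume_ge0..].
apply: leeD; apply: ereal_inf_lbound.
- exists (fun k => lo (F k)) => // x [/XF[k _ Fx] /= xc]; exists k => // j.
  rewrite /= mxE; have /andP[-> /= xj] := Fx j.
  by case: eqP => // ji; rewrite le_min xj ji.
- exists (fun k => hi (F k)) => // x [/XF[k _ Fx] /= /negP xc]; exists k => // j.
  rewrite /= mxE; have /andP[xj ->] := Fx j; rewrite andbT.
  by case: eqP => // ji; rewrite gt_max xj ji ltNge.
Qed.

Lemma measurable_coord (i : 'I_n.+1) (D : set (euclid R n)) :
  measurable_fun D (fun x : euclid R n => x ord0 i).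
Proof.
move=> mD; apply: (measurability _ (RGenOInfty.measurableE R)) => //.
move=> _ [_ [c ->] <-]; apply: measurableI => //.
rewrite (_ : _ @^-1` _ = ~` [set x : euclid R n | x ord0 i <= c]).
  by apply: measurableC; exact: caratheodory_halfspace.
by apply/seteqP; split => x /=; rewrite in_itv/= andbT ltNge => /negP.
Qed.

Lemma box_measure_le B : (outer (box B) <= box_volume B)%E.
Proof.
apply: ereal_inf_lbound; exists (fun k => if k is 0%N then B else (0, 0)).
  by move=> x Bx; exists 0%N.
rewrite (nneseries_split 0 1)//; last by move=> *; exact: box_volume_ge0.
rewrite big_nat1 eseries0 ?adde0// => -[//|k] _ _.
by rewrite /box_volume big_ord_recl subrr maxxx mul0r.
Qed.

(* Integrate the covering inequality one coordinate at a time. *)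
Lemma unit_interval_cover (m : nat) (u v : nat -> nat -> R) (w : nat -> R) :
  (forall k, 0 <= w k) ->
  (forall x : nat -> R,
    ((\prod_(i < m) \1_(`]0, 1]) (x i))%:E <=
     \sum_(k <oo) (w k * \prod_(i < m) \1_(`]u k i, v k i]) (x i))%:E)%E) ->
  (1 <= \sum_(k <oo) (w k * \prod_(i < m) Num.max 0 (v k i - u k i))%:E)%E.
Proof.
elim: m w => [|m IH] w w0 h.
  have := h (fun=> 0); rewrite big_ord0.
  by under eq_eseriesr do rewrite big_ord0;
    under [in X in _ -> X]eq_eseriesr do rewrite big_ord0.
(* The length of the last side moves into the weight; this is why the statement carries weights at
   all. *)
pose w' k := Num.max 0 (v k m - u k m) * w k.
rewrite (eq_eseriesr (g := fun k =>
  (w' k * \prod_(i < m) Num.max 0 (v k i - u k i))%:E)); last first.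
  by move=> k _; rewrite big_ord_recr/= /w'; congr (_%:E); ring.
apply: (IH w') => [k|x]; first by rewrite mulr_ge0// le_max lexx.
have ind0 (A : set R) t : 0 <= (\1_A t : R) by rewrite indicE.
(* The first [m] coordinates are frozen and the last one becomes the variable of integration. *)
pose y t i := if (i == m)%N then t else x i.
have yE t (A : nat -> set R) : \prod_(i < m.+1) \1_(A i) (y t i) =
    (\prod_(i < m) \1_(A i) (x i)) * \1_(A m) t :> R.
  rewrite big_ord_recr /= /y eqxx; congr (_ * _).
  by apply: eq_bigr => i _; rewrite ltn_eqF.
have int_ind (c p q : R) : 0 <= c -> (\int[lebesgue_measure]_t (c * \1_(`]p,
  q]) t)%:E =
    (c * Num.max 0 (q - p))%:E)%E.
  move=> c0; under eq_integral do rewrite EFinM.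
  rewrite ge0_integralZl//; last by apply/measurable_EFinP; exact: measurable_indic.
  rewrite integral_indic//= setIT lebesgue_measure_itv/= lte_fin EFinM;
    congr (_ * _)%E.
  by case: ltP => pq; rewrite -?EFinB; congr (_%:E);
    [apply/esym/max_r|apply/esym/max_l]; lra.
have prod0 (A : nat -> set R) : 0 <= \prod_(i < m) \1_(A i) (x i) :> R.
  by apply: prodr_ge0.
pose c k := w k * \prod_(i < m) \1_(`]u k i, v k i]) (x i).
have c0 k : 0 <= c k by rewrite mulr_ge0//;
  exact: (prod0 (fun i => `]u k i, v k i]%classic)).
rewrite (_ : \prod_(i < m) _ = (\prod_(i < m) \1_(`]0,
  1]) (x i)) * Num.max 0 (1 - 0)); last first.
  by rewrite subr0 (max_r ler01) mulr1.
rewrite -(int_ind _ _ _ (prod0 (fun=> `]0, 1]%classic))).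
rewrite (eq_eseriesr (g := fun k => (c k * Num.max 0 (v k m - u k m))%:E));
  last first.
  by move=> k _; congr (_%:E); rewrite /w' /c; ring.
rewrite (eq_eseriesr (fun k _ => esym (int_ind _ (u k m) (v k m) (c0 k)))).
(* All terms are nonnegative, so series and integral commute, and it remains to compare the
   integrands at each [t]. *)
rewrite -integral_nneseries//; first last.
- by move=> k t _; rewrite lee_fin mulr_ge0.
- by move=> k; apply/measurable_EFinP; exact: measurable_funM.
apply: ge0_le_integral => //.
- by move=> t _; rewrite lee_fin mulr_ge0//; exact: (prod0 (fun=> `]0, 1]%classic)).
- by apply/measurable_EFinP; exact: measurable_funM.
- apply: ge0_emeasurable_sum => [k t _ _|k _]; last by apply/measurable_EFinP;
  exact: measurable_funM.
  by rewrite lee_fin mulr_ge0.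
- move=> t _; rewrite -(yE t (fun=> `]0, 1]%classic)).
  apply: le_trans (h (y t)) _.
  apply: lee_nneseries => k _.
    by move=> _; rewrite lee_fin mulr_ge0//; apply: prodr_ge0.
  by rewrite (yE t (fun i => `]u k i, v k i]%classic)) mulrA.
Qed.

(** The box covers itself, which gives the upper bound. The lower bound is [unit_interval_cover]
    with all weights 1, applied to an arbitrary covering. *)
Lemma lebesgue_unit_box : (outer (box (0%R, const_mx 1%R)) = 1)%E.
Proof.
apply/eqP; rewrite eq_le; apply/andP; split.
  apply: le_trans (box_measure_le _) _; rewrite /box_volume lee_fin.
  by rewrite big1// => i _; rewrite !mxE subr0 max_r.
apply: le_ereal_inf_tmp => _ [F BF <-].
pose u k i := (F k).1 ord0 (inord i); pose v k i := (F k).2 ord0 (inord i).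
have := @unit_interval_cover n.+1 u v (fun=> 1) (fun=> ler01).
have ordE (i : 'I_n.+1) : inord i = i by apply: val_inj; rewrite /= inordK.
have -> : (\sum_(k <oo) (1 * \prod_(i < n.+1) Num.max 0 (v k i - u k i))%:E =
    \sum_(k <oo) box_volume (F k))%E.
  apply: eq_eseriesr => k _; rewrite mul1r /box_volume; congr (_%:E).
  by apply: eq_bigr => i _; rewrite /u /v ordE.
apply => x.
have s0 k : (0 <= (1 * \prod_(i < n.+1) \1_(`]u k i, v k i]) (x i))%:E :> \bar R)%E.
  by rewrite mul1r lee_fin; apply: prodr_ge0 => i _; rewrite indicE.
(* Outside the unit box the left-hand product is 0; inside, a single box containing the point
   already contributes 1 to the series. *)
have [x01|] := pselect (box (0, const_mx 1) (\row_i x i : euclid R n)); last first.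
  move/existsNP => [i /negP ni]; rewrite (bigD1 i)//= indicE memNset ?mul0r.
    by apply: nneseries_ge0.
  by move=> /=; rewrite in_itv/=; move: ni; rewrite !mxE => /negP.
have [k _ Fk] := BF _ x01.
apply: (@le_trans _ _ 1%E).
  by rewrite lee_fin; apply: prodr_ile1 => i _; rewrite indicE; case: (_ \in _);
    rewrite ?lexx ?ler01.
apply: (@le_trans _ _ (1 * \prod_(i < n.+1) \1_(`]u k i, v k i]) (x i))%:E).
  rewrite mul1r lee_fin big1// => i _; rewrite indicE mem_set//=.
  by rewrite in_itv/= /u /v ordE; have := Fk i; rewrite !mxE.
rewrite (nneseries_split 0 k.+1)// add0n big_mkord.
rewrite [X in (_ <= X + _)%E](bigD1 (Ordinal (ltnSn k)))//= -addeA leeDl//.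
by rewrite adde_ge0 ?nneseries_ge0 ?sume_ge0.
Qed.

End measure_of_boxes.

(** * Affine maps and cubes *)

Section affine_maps.
Context (R : realType) (n : nat).
Implicit Types (a x : euclid R n) (B : euclid R n * euclid R n) (l : R).
Notation mu := (@lebesgue R n).
Notation outer := (@lebesgue_outer R n).

Definition affine a l x : euclid R n := a + l *: x.

Lemma affineE a l x i : affine a l x ord0 i = a ord0 i + l * x ord0 i.
Proof. by rewrite !mxE. Qed.

Lemma affineK a l : l != 0 -> cancel (affine a l) (affine (- (l^-1 *: a)) l^-1).
Proof.
by move=> l0 x; apply/rowP => i; rewrite !mxE mulrDr mulKf// addKr.
Qed.

Lemma affineVK a l : l != 0 -> cancel (affine (- (l^-1 *: a)) l^-1) (affine a l).
Proof.
by move=> l0 x; apply/rowP => i; rewrite !mxE mulrDr mulrN !mulVKf// addNKr.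
Qed.

(** Coverings of [A] are pulled back by the inverse map, which multiplies each of the [n.+1] side
    lengths by [l^-1]. *)
Lemma outer_affine_le a l (A : set (euclid R n)) : 0 < l ->
  (outer (affine a l @^-1` A) <= (l^-1 ^+ n.+1)%:E * outer A)%E.
Proof.
move=> l0; have lX0 : 0 < l^-1 ^+ n.+1 by rewrite exprn_gt0// invr_gt0.
rewrite -lee_pdivrMl//; apply: le_ereal_inf_tmp => _ [F AF <-].
rewrite lee_pdivrMl//.
pose G k := ((affine (- (l^-1 *: a)) l^-1 (F k).1),
  affine (- (l^-1 *: a)) l^-1 (F k).2).
have -> : ((l^-1 ^+ n.+1)%:E * \sum_(k <oo) box_volume (F k) =
    \sum_(k <oo) box_volume (G k))%E.
  rewrite -nneseriesZl; last by move=> *; exact: box_volume_ge0.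
  apply: eq_eseriesr => k _; rewrite /box_volume -EFinM; congr (_%:E).
  rewrite -[X in l^-1 ^+ X]card_ord -prodr_const -big_split/=.
  apply: eq_bigr => i _; rewrite maxr_pMr ?invr_ge0 ?ltW// mulr0.
  by congr Num.max; rewrite !mxE; ring.
apply: ereal_inf_lbound; exists G => // x /AF[k _ Fk]; exists k => // i.
rewrite /=.
have -> : x ord0 i = affine (- (l^-1 *: a)) l^-1 (affine a l x) ord0 i.
  by rewrite affineK// gt_eqF.
rewrite !affineE.
by rewrite !(ltrD2l, lerD2l) ltr_pM2l ?ler_pM2l ?invr_gt0//; have := Fk i;
  rewrite affineE.
Qed.

(** The missing inequality is [outer_affine_le] for the inverse map, applied to the preimage of
    [A]. *)
Lemma outer_affine a l (A : set (euclid R n)) : 0 < l ->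
  (outer (affine a l @^-1` A) = (l^-1 ^+ n.+1)%:E * outer A)%E.
Proof.
move=> l0; apply/eqP; rewrite eq_le outer_affine_le//=.
have lX0 : 0 < l^-1 ^+ n.+1 by rewrite exprn_gt0// invr_gt0.
have := @outer_affine_le (- (l^-1 *: a)) l^-1 (affine a l @^-1` A).
rewrite invr_gt0 => /(_ l0); rewrite invrK -comp_preimage.
rewrite (_ : _ \o _ = id); last by apply/funext => x /=; rewrite affineVK ?gt_eqF.
by rewrite preimage_id -lee_pdivlMl// exprVn invrK.
Qed.

(** Continuity would only handle Borel sets, whereas the measurable sets here are those of
    Caratheodory. The criterion is transported by the scaling of the outer measure; as the map is
    bijective, every test set is the preimage of some set. *)
Lemma measurable_affine a l : 0 < l -> measurable_fun setT (affine a l).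
Proof.
move=> l0 _ A; rewrite setTI.
rewrite -[measurable A]/(caratheodory_measurable outer A) => mA.
suff : caratheodory_measurable outer (affine a l @^-1` A) by [].
have pull Y : outer (affine a l @^-1` Y) =
  (outer (affine a l @^-1` Y `&` affine a l @^-1` A) +
    outer (affine a l @^-1` Y `&` ~` (affine a l @^-1` A)))%E.
  rewrite preimage_setC -2!preimage_setI (outer_affine a Y l0).
  rewrite (outer_affine a (Y `&` A) l0) (outer_affine a (Y `&` ~` A) l0) (mA Y).
  by rewrite ge0_muleDr//; exact: lebesgue_outer_ge0.
move=> X; have := pull (affine (- (l^-1 *: a)) l^-1 @^-1` X).
rewrite -comp_preimage (_ : _ \o _ = id) ?preimage_id//.
by apply/funext => x /=; rewrite affineK ?gt_eqF.
Qed.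

End affine_maps.

(** * Cubes: measurability, boundedness, positive and finite measure *)

Section cubes.
Context (R : realType) (n : nat).
Implicit Types (a x : euclid R n) (l : R) (b c : 'I_n.+1 -> bool).
Notation mu := (@lebesgue R n).
Notation outer := (@lebesgue_outer R n).

(** The data hidden by the existential in [cube], exposed so that the endpoint pattern [b], [c] can
    be followed through affine maps. *)
Definition cube_at a l b c : set (euclid R n) :=
  [set x | forall i, x ord0 i \in
        Interval (BSide (b i) (a ord0 i)) (BSide (c i) (a ord0 i + l))].

Lemma cube_cube_at a l b c : 0 < l -> cube (cube_at a l b c).
Proof. by move=> l0; exists a, l, b, c. Qed.

Lemma preimage_affine_cube a l b c : 0 < l ->
  affine a l @^-1` cube_at a l b c = cube_at 0 1 b c.
Proof.
move=> l0; have lE y : (l * y <= l) = (y <= 1) by rewrite -{2}(mulr1 l) ler_pM2l.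
have ltE y : (l * y < l) = (y < 1) by rewrite -{2}(mulr1 l) ltr_pM2l.
have itvE u y (d e : bool) : (u + l * y \in Interval (BSide d u) (BSide e (u + l))) =
    (y \in Interval (BSide d 0) (BSide e 1)).
  by rewrite !in_itv/=; case: d; case: e => /=;
    rewrite ?lerDl ?ltrDl ?lerD2l ?ltrD2l ?pmulr_rge0 ?pmulr_rgt0 ?lE ?ltE.
by apply/seteqP; split => x /= h i; have := h i; rewrite affineE mxE add0r itvE.
Qed.

Lemma measurable_cube (Q : set (euclid R n)) : cube Q -> measurable Q.
Proof.
move=> [a [l [b [c [l0 ->]]]]].
rewrite [X in measurable X](_ : _ =
  \bigcap_(i : 'I_n.+1) ((fun x : euclid R n => x ord0 i) @^-1`
   [set` Interval (BSide (b i) (a ord0 i)) (BSide (c i) (a ord0 i + l))]));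
     last first.
  by apply/seteqP; split=> x h i => [_|]; exact: h.
apply: fin_bigcap_measurable => [|i _]; first exact: finite_finset.
rewrite -[X in measurable X]setTI.
by apply: measurable_coord.
Qed.

Lemma box_measure_lty (B : euclid R n * euclid R n) : (outer (box B) < +oo)%E.
Proof. exact: le_lt_trans (box_measure_le B) (ltry _). Qed.

(** The pull-back of this box is the unit box, so measure 0 would turn the scaling identity into
    [1 = 0]. *)
Lemma box_measure_gt0 a l : 0 < l -> (0 < outer (box (a, (a + const_mx l)%R)))%E.
Proof.
move=> l0; have := @outer_affine _ _ a l (box (a, a + const_mx l)) l0.
rewrite (_ : _ @^-1` _ = box (0, const_mx 1)).
  rewrite lebesgue_unit_box => /esym/eqP; apply: contraTT => /=.
  rewrite -leNgt => h; rewrite (_ : outer _ = 0%E) ?mule0 ?lt_eqF// ?lte_fin//.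
  by apply/eqP; rewrite eq_le h lebesgue_outer_ge0.
have lE y : (l * y <= l) = (y <= 1) by rewrite -{2}(mulr1 l) ler_pM2l.
by apply/seteqP; split => x h i; have := h i;
  rewrite /= !mxE ltrDl lerD2l pmulr_rgt0// lE.
Qed.

Lemma cube_measure_gt0 (Q : set (euclid R n)) : cube Q -> (0 < mu Q)%E.
Proof.
move=> [a [l [b [c [l0 ->]]]]].
(* The middle third in each direction stays away from all faces, so this half-open box lies in the
   cube for every endpoint pattern. *)
have l3 : 0 < l / 3 by rewrite divr_gt0.
apply: lt_le_trans (box_measure_gt0 (a + const_mx (l / 3)) l3) _.
apply: lebesgue_outer_le => x h i; have /andP[/=] := h i; rewrite !mxE => h1 h2.
by rewrite in_itv/=; case: (b i); case: (c i) => /=; apply/andP; split; lra.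
Qed.

Lemma normr_coord_le x i : `|x ord0 i| <= `|x|.
Proof.
rewrite -[leRHS]/(mx_norm (x : 'rV_n.+1)) mx_normrE.
exact: (le_bigmax _ (fun ij => `|x ij.1 ij.2|) (ord0, i)).
Qed.

Lemma euclid_norm_le x (M : R) :
  0 <= M -> (forall i, `|x ord0 i| <= M) -> `|x| <= M.
Proof.
move=> M0 xM; rewrite -[leLHS]/(mx_norm (x : 'rV_n.+1)) mx_normrE.
by apply: bigmax_le => // -[i j] _ /=; rewrite (ord1 i).
Qed.

Lemma bounded_set_box (A : set (euclid R n)) : bounded_set A ->
  exists M : R, A `<=` box (const_mx (- M), const_mx M).
Proof.
move=> [M [_ /(_ (M + 1))]]; rewrite ltrDl ltr01 => /(_ isT) AM.
(* The set is bounded by [M + 1]; the extra unit makes the lower inequality strict, as boxes omit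
   their lower faces. *)
exists (M + 2) => x /AM /= xM i; rewrite !mxE.
have /(le_trans (normr_coord_le x i)) := xM.
by rewrite ler_norml => /andP[h1 h2]; apply/andP; split; lra.
Qed.

Lemma bounded_measure_lty (A : set (euclid R n)) : bounded_set A -> (mu A < +oo)%E.
Proof.
move=> /bounded_set_box[M AM].
exact: le_lt_trans (lebesgue_outer_le AM) (box_measure_lty _).
Qed.

Lemma bounded_cube (Q : set (euclid R n)) : cube Q -> bounded_set Q.
Proof.
move=> [a [l [b [c [l0 ->]]]]]; exists (`|a| + l); split => [|M aM x h].
  exact: num_real.
have a0 := normr_ge0 a; apply: euclid_norm_le => [|j]; first lra.
have := normr_coord_le a j; have := h j;
  rewrite in_itv/= => /andP[/lteifW h1 /lteifW h2].
by rewrite !ler_norml => /andP[h3 h4]; apply/andP; split; lra.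
Qed.

Lemma cube_measure_fin (Q : set (euclid R n)) : cube Q -> mu Q \is a fin_num.
Proof.
by move=> cQ; rewrite ge0_fin_numE ?measure_ge0// bounded_measure_lty//;
  exact: bounded_cube.
Qed.

End cubes.

(** * Polynomial functions *)

Section polynomial_functions.
Context (R : realType) (n : nat).
Implicit Types (P V : mpoly n.+1 R) (x : euclid R n) (Q D : set (euclid R n)).
Notation mu := (@lebesgue R n).

Lemma polyevalE P x : polyeval P x = \sum_(m <- msupp P) mcoeff m P * monomial m x.
Proof. by []. Qed.

Lemma polyevalX g : polyeval (mpolyX R g) = @monomial R n g.
Proof. by apply/funext => x; rewrite /polyeval mevalX. Qed.

Lemma measurable_polyeval P D : measurable_fun D (polyeval P).
Proof.
apply: measurable_sum => m; apply: measurable_funM => //.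
apply: measurable_prod => i _; apply: measurable_funX.
exact: measurable_coord.
Qed.

Lemma continuous_polyeval P : continuous (polyeval P).
Proof.
pose C (h : euclid R n -> R) := continuous h.
have CD g h : C g -> C h -> C (g \+ h) by move=> cg ch x;
  exact: continuousD (cg x) (ch x).
have CM g h : C g -> C h -> C (g \* h) by move=> cg ch x;
  exact: continuousM (cg x) (ch x).
have C1 r : C (fun=> r) by exact: cst_continuous.
have Ci (i : 'I_n.+1) : C (fun x : euclid R n =>
  x ord0 i) by exact: (@coord_continuous R 1 n.+1 ord0 i).
have CX (i : 'I_n.+1) k : C (fun x : euclid R n => x ord0 i ^+ k).
  elim: k => [|k IH]; first by under eq_fun do rewrite expr0; exact: C1.
  by under eq_fun do rewrite exprS; exact: CM.
have Cprod (s : seq 'I_n.+1) (m : multinom n.+1) :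
    C (fun x => \prod_(i <- s) x ord0 i ^+ m i).
  elim: s => [|i s IH]; first by under eq_fun do rewrite big_nil; exact: C1.
  by under eq_fun do rewrite big_cons; exact: CM.
have : forall s : seq (multinom n.+1), C (fun x =>
  \sum_(m <- s) mcoeff m P * monomial m x).
  elim=> [|m s IH]; first by under eq_fun do rewrite big_nil; exact: C1.
  by under eq_fun do rewrite big_cons; apply: CD => //; apply: CM => //; exact: Cprod.
exact.
Qed.

Lemma bounded_polyeval P D : bounded_set D -> [bounded polyeval P x | x in D].
Proof.
move=> [M [_ /(_ (`|M| + 1))]];
  rewrite (le_lt_trans (ler_norm M)) ?ltrDl// => /(_ isT) DM.
exists (\sum_(m <- msupp P) `|mcoeff m P| * \prod_(i < n.+1) (`|M| + 1) ^+ m i);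
  split.
  exact: num_real.
move=> K /ltW; set S := \sum_(m <- _) _ => SK x Dx /=; apply: le_trans SK;
  rewrite polyevalE.
apply: le_trans (ler_norm_sum _ _ _) _; apply: ler_sum => m _.
rewrite normrM ler_wpM2l// normr_prod; apply: ler_prod => i _.
rewrite normr_ge0 normrX lerXn2r// ?nnegrE ?addr_ge0//.
by apply: le_trans (normr_coord_le x i) _; exact: DM.
Qed.

Lemma integrable_polyevalM Q (f : euclid R n -> R) P : cube Q ->
  mu.-integrable Q (EFin \o f) ->
  mu.-integrable Q (EFin \o (fun x => f x * polyeval P x)).
Proof.
move=> cQ fQ; apply: (@integrableMl _ _ _ mu Q _ (EFin \o f) (polyeval P)) => //.
- exact: measurable_cube.
- exact: measurable_polyeval.
- by apply: bounded_polyeval; exact: bounded_cube.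
Qed.

Lemma integrable_polyeval Q P : cube Q -> mu.-integrable Q (EFin \o polyeval P).
Proof.
move=> cQ; apply: measurable_bounded_integrable.
- exact: measurable_cube.
- by apply: bounded_measure_lty; exact: bounded_cube.
- exact: measurable_polyeval.
- by apply: bounded_polyeval; exact: bounded_cube.
Qed.

Lemma integrable_sub_polyeval Q (f : euclid R n -> R) P : cube Q ->
  mu.-integrable Q (EFin \o f) ->
  mu.-integrable Q (EFin \o (fun x => f x - polyeval P x)).
Proof.
move=> cQ fQ.
apply: (@integrableB _ _ _ mu Q _ (EFin \o f) (EFin \o polyeval P)) => //.
- exact: measurable_cube.
- exact: integrable_polyeval.
Qed.

Lemma Rintegral_sum (I : Type) (r : seq I) Q (h : I -> euclid R n -> R) :
  measurable Q -> (forall i, mu.-integrable Q (EFin \o h i)) ->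
  \int[mu]_(x in Q) (\sum_(i <- r) h i x) = \sum_(i <- r) \int[mu]_(x in Q) h i x.
Proof.
move=> mQ ih; elim: r => [|i r IH].
  by under eq_Rintegral do rewrite big_nil; rewrite big_nil Rintegral_cst// mul0r.
under eq_Rintegral do rewrite big_cons.
rewrite big_cons -IH RintegralD//.
rewrite (_ : EFin \o _ = (fun x => \sum_(j <- r) (EFin \o h j) x)%E).
  by apply: integrable_sum => // j _; exact: ih.
by apply/funext => x /=; rewrite sumEFin.
Qed.

(** Linearity extends the orthogonality from monomials to polynomials. It is used with [V = P] for
    the Gram matrix and with affinely transformed monomials for the change of variables. *)
Lemma is_polyprojP s Q f P : cube Q -> mu.-integrable Q (EFin \o f) ->
  is_polyproj s Q f P ->
  forall V, (msize V <= s.+1)%N ->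
    \int[mu]_(x in Q) ((f x - polyeval P x) * polyeval V x) = 0.
Proof.
move=> cQ fQ [Ps h] V Vs; have mQ := measurable_cube cQ.
have ifP : mu.-integrable Q (EFin \o (fun x => f x - polyeval P x)).
  exact: integrable_sub_polyeval.
have iM m : mu.-integrable Q (EFin \o (fun x => (f x - polyeval P x) * monomial m x)).
  by have := integrable_polyevalM (mpolyX R m) cQ ifP; rewrite polyevalX.
rewrite (@eq_Rintegral _ _ R mu Q (fun x => \sum_(m <- msupp V)
    mcoeff m V * ((f x - polyeval P x) * monomial m x))); last first.
  move=> x _; rewrite [polyeval V x]polyevalE mulr_sumr; apply: eq_bigr => m _.
  by rewrite mulrCA.
rewrite Rintegral_sum//; last first.
  by move=> m; apply: (integrableZl mQ (mcoeff m V) (iM m)).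
rewrite big_seq big1// => m mV; rewrite RintegralZl// h ?mulr0//.
by have := leq_trans (msize_mdeg_lt mV) Vs; rewrite ltnS.
Qed.

End polynomial_functions.

(** * Transport of integrals and projections by affine maps *)

Section affine_transfer.
Context (R : realType) (n : nat).
Implicit Types (P V : mpoly n.+1 R) (a x : euclid R n) (Q D : set (euclid R n))
  (l : R).
Notation mu := (@lebesgue R n).

Definition affine_poly a l P : mpoly n.+1 R :=
  comp_mpoly [tuple (mpolyC n.+1 (a ord0 i) + l *: mpolyX R (mnm1 i))%R | i < n.+1] P.

Lemma polyeval_affine a l P x : polyeval (affine_poly a l P) x =
  polyeval P (affine a l x).
Proof.
rewrite /polyeval comp_mpoly_meval; apply: meval_eq => i.
by rewrite tnth_mktuple mevalD mevalC mevalZ mevalXU affineE.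
Qed.

Lemma msize_affine_poly a l P : (msize (affine_poly a l P) <= msize P)%N.
Proof.
rewrite /affine_poly comp_mpolyE; set t := [tuple _ | _ < _].
(* Degrees add under multiplication; since [msize] is the degree plus one, the bound is
   [(i + j).+1]. The zero polynomial, of size 0, is treated apart. *)
have mulle p q i j : (msize p <= i.+1)%N -> (msize q <= j.+1)%N ->
  (msize (p * q : mpoly n.+1 R) <= (i + j).+1)%N.
  have [->|p0] := eqVneq p 0; first by rewrite mul0r msize0.
  have [->|q0] := eqVneq q 0; first by rewrite mulr0 msize0.
  by rewrite msizeM// => pi qj; rewrite -subn1 leq_subLR;
    apply: leq_trans (leq_add pi qj) _; rewrite addSn addnS.
have t2 i : (msize (tnth t i) <= 2)%N.
  rewrite tnth_mktuple; apply: leq_trans (msizeD_le _ _) _; rewrite geq_max.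
  rewrite (leq_trans (msizeZ_le _ _)) ?msizeX ?mdeg1// andbT.
  by rewrite msizeC; case: (_ == _).
have tX i k : (msize (tnth t i ^+ k) <= k.+1)%N.
  elim: k => [|k IH]; first by rewrite expr0 msize1.
  by rewrite exprS; apply: (mulle _ _ 1%N k).
apply: leq_trans (msize_sum _ _ _) _.
apply/bigmax_leqP_seq => m mP _; apply: leq_trans (msizeZ_le _ _) _.
apply: leq_trans (msize_mdeg_lt mP); rewrite mdegE.
elim/big_rec2 : _ => [|i k p _ IH]; first by rewrite msize1.
by apply: mulle.
Qed.

(** By [outer_affine], the image of the measure under the affine map is the measure itself times
    [l^-1 ^+ n.+1]. *)
Lemma ge0_integral_affine a l D (f : euclid R n -> \bar R) : 0 < l ->
  measurable D -> measurable_fun D f -> (forall x, D x -> (0 <= f x)%E) ->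
  (\int[mu]_(x in affine a l @^-1` D) f (affine a l x) =
   (l^-1 ^+ n.+1)%:E * \int[mu]_(x in D) f x)%E.
Proof.
move=> l0 mD mf f0; have k0 : 0 <= l^-1 ^+ n.+1 by rewrite exprn_ge0// invr_ge0 ltW.
rewrite -[LHS](ge0_integral_pushforward (measurable_affine a l0) mu mD mf);
  last first.
  by move=> x /set_mem; exact: f0.
rewrite -(ge0_integral_mscale mu mD (NngNum k0) mf f0).
apply: (@eq_measure_integral _ _ R D (mscale (NngNum k0) mu)) => [|? A _ _].
  exact: measurable_affine.
exact: (outer_affine a A l0).
Qed.

Lemma measurable_fun_affine a l D (f : euclid R n -> R) : 0 < l ->
  measurable D -> measurable_fun D f ->
  measurable_fun (affine a l @^-1` D) (f \o affine a l).
Proof.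
move=> l0 mD mf; apply: (measurable_comp mD) => //;
  first exact: image_preimage_subset.
by apply: (measurable_funS measurableT) => //; exact: measurable_affine.
Qed.

Lemma integrable_affine a l D (f : euclid R n -> R) : 0 < l ->
  measurable D -> mu.-integrable D (EFin \o f) ->
  mu.-integrable (affine a l @^-1` D) (EFin \o (f \o affine a l)).
Proof.
move=> l0 mD /integrableP[/measurable_EFinP mf foo]; apply/integrableP; split.
  by apply/measurable_EFinP; exact: measurable_fun_affine.
rewrite /= (ge0_integral_affine a l0 mD (f := fun x => `|(f x)%:E|%E))//.
  by rewrite lte_mul_pinfty// lee_fin exprn_ge0// invr_ge0 ltW.
by apply: measurableT_comp => //; exact/measurable_EFinP.
Qed.

Lemma Rintegral_affine a l D (f : euclid R n -> R) : 0 < l ->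
  measurable D -> mu.-integrable D (EFin \o f) ->
  \int[mu]_(x in affine a l @^-1` D) f (affine a l x) =
   l^-1 ^+ n.+1 * \int[mu]_(x in D) f x.
Proof.
move=> l0 mD fi; have mf := measurable_int _ fi.
rewrite /Rintegral integralE [in RHS]integralE.
have pE : ((fun x => (f (affine a l x))%:E)^\+ = (EFin \o f)^\+ \o affine a l)%E.
  exact: (funepos_comp (EFin \o f) (affine a l)).
have nE : ((fun x => (f (affine a l x))%:E)^\- = (EFin \o f)^\- \o affine a l)%E.
  exact: (funeneg_comp (EFin \o f) (affine a l)).
rewrite pE nE (ge0_integral_affine a l0 mD (f := ((EFin \o f)^\+)%E))//;
  last exact/measurable_funepos.
rewrite (ge0_integral_affine a l0 mD (f := ((EFin \o f)^\-)%E))//;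
  last exact/measurable_funeneg.
have fp := integrable_fin_num mD (integrable_funepos mD fi).
have fn := integrable_fin_num mD (integrable_funeneg mD fi).
by rewrite -muleBr ?fin_num_adde_defr// fineM// fin_numB fp fn.
Qed.

Lemma is_polyproj_affine s a l Q f P : 0 < l -> cube Q ->
  mu.-integrable Q (EFin \o f) ->
  is_polyproj s Q f P ->
  is_polyproj s (affine a l @^-1` Q) (f \o affine a l) (affine_poly a l P).
Proof.
move=> l0 cQ fQ PP; have [Ps _] := PP; split;
  first exact: leq_trans (msize_affine_poly _ _ _) Ps.
(* Seen from [Q], the test monomial [g] is no longer a monomial, but still a polynomial of degree at
   most [s], so [is_polyprojP] applies to it. *)
move=> g gs; pose V := affine_poly (- (l^-1 *: a)) l^-1 (mpolyX R g).
have Vs : (msize V <=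
  s.+1)%N by rewrite (leq_trans (msize_affine_poly _ _ _))// msizeX.
have VE x : monomial g x = polyeval V (affine a l x).
  by rewrite polyeval_affine affineK ?gt_eqF// /polyeval mevalX.
under eq_Rintegral do rewrite polyeval_affine VE.
rewrite (Rintegral_affine a l0 (measurable_cube cQ) (f := fun x =>
  (f x - polyeval P x) * polyeval V x)).
  by rewrite (is_polyprojP cQ fQ PP Vs) mulr0.
by apply: integrable_polyevalM => //; exact: integrable_sub_polyeval.
Qed.

End affine_transfer.

(** * The Gram matrix on the unit cube *)

Section gram.
Context (R : realType) (n s : nat) (b c : 'I_n.+1 -> bool).
Implicit Types (f : euclid R n -> R) (x : euclid R n).
Notation mu := (@lebesgue R n).
Notation idx := (bmultinom n.+1 s.+1).
Let U : set (euclid R n) := cube_at 0 1 b c.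
(** The bound in [bmultinom] is strict, so [s.+1] encodes degree at most [s]; ordinals are used
    because they index matrices. *)
Let m (i : 'I_#|{: idx}|) : multinom n.+1 := bmnm (enum_val i).

Let cU : cube U. Proof. exact: cube_cube_at. Qed.
Let mU : measurable U. Proof. exact: measurable_cube. Qed.

Let mdeg_m i : (mdeg (m i) <= s)%N.
Proof. by rewrite -ltnS; exact: bmdeg. Qed.

Let m_surj (g : multinom n.+1) : (mdeg g <= s)%N -> exists i, g = m i.
Proof.
rewrite -ltnS => gs; exists (enum_rank (BMultinom gs : idx)).
by rewrite /m enum_rankK.
Qed.

Definition gram : 'M[R]_#|{: idx}| :=
  \matrix_(i, j) \int[mu]_(x in U) (monomial (m i) x * monomial (m j) x).

Definition moments f : 'rV[R]_#|{: idx}| :=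
  \row_j \int[mu]_(x in U) (f x * monomial (m j) x).

Definition poly_of_row (v : 'rV[R]_#|{: idx}|) : mpoly n.+1 R :=
  \sum_i v ord0 i *: mpolyX R (m i).

Lemma msize_poly_of_row v : (msize (poly_of_row v) <= s.+1)%N.
Proof.
apply: leq_trans (msize_sum _ _ _) _; apply/bigmax_leqP_seq => i _ _.
by rewrite (leq_trans (msizeZ_le _ _))// msizeX ltnS.
Qed.

Lemma polyeval_poly_of_row v x :
  polyeval (poly_of_row v) x = \sum_i v ord0 i * monomial (m i) x.
Proof.
rewrite /polyeval /poly_of_row raddf_sum; apply: eq_bigr => i _.
by rewrite /= mevalZ mevalX.
Qed.

Lemma poly_of_row_surj P : (msize P <= s.+1)%N -> exists v, P = poly_of_row v.
Proof.
move=> Ps; exists (\row_i mcoeff (m i) P); rewrite [LHS](mpolywE Ps).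
rewrite /poly_of_row; under [RHS]eq_bigr do rewrite mxE.
rewrite -(big_enum_val (A := {: idx}) (fun k : idx =>
  mcoeff (bmnm k) P *: mpolyX R (bmnm k))).
exact: eq_bigl.
Qed.

Let integrable_monomialM f g : mu.-integrable U (EFin \o f) ->
  mu.-integrable U (EFin \o (fun x => f x * monomial g x)).
Proof.
by move=> /(integrable_polyevalM (mpolyX R g) cU); rewrite polyevalX.
Qed.

Let integrable_monomial g : mu.-integrable U (EFin \o (@monomial R n g)).
Proof.
by have := integrable_polyeval (mpolyX R g) cU; rewrite polyevalX.
Qed.

Lemma moments_poly v : moments (polyeval (poly_of_row v)) = v *m gram.
Proof.
apply/rowP => j; rewrite !mxE.
rewrite (@eq_Rintegral _ _ R mu U (fun x => \sum_i v ord0 i *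
    (monomial (m i) x * monomial (m j) x))); last first.
  move=> x _; rewrite polyeval_poly_of_row mulr_suml; apply: eq_bigr => i _.
  by rewrite mulrA.
have im i := integrable_monomialM (m j) (integrable_monomial (m i)).
rewrite Rintegral_sum//; last by move=> i; exact: (integrableZl mU (v ord0 i) (im i)).
by apply: eq_bigr => i _; rewrite RintegralZl// mxE.
Qed.

Lemma is_polyproj_row f v : mu.-integrable U (EFin \o f) ->
  is_polyproj s U f (poly_of_row v) <-> v *m gram = moments f.
Proof.
move=> fU; have iv := integrable_polyeval (poly_of_row v) cU.
have E j : \int[mu]_(x in U) ((f x - polyeval (poly_of_row v) x) * monomial (m j) x) =
    moments f ord0 j - (v *m gram) ord0 j.
  rewrite -moments_poly !mxE -RintegralB//; try exact: integrable_monomialM.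
  by apply: eq_Rintegral => x _; rewrite mulrBl.
split => [[_ h]|vE].
  apply/rowP => j; apply/esym/eqP; rewrite -subr_eq0 -E; apply/eqP; exact: h.
split; first exact: msize_poly_of_row.
by move=> g /m_surj[j ->]; rewrite E vE subrr.
Qed.

(** If [P] were nonzero at an interior point, its square would by continuity exceed a positive
    constant on a small box inside [U], and this box has positive measure. *)
Lemma polyeval_eq0_of_Rintegral P : \int[mu]_(x in U) (polyeval P x * polyeval P
  x) = 0 ->
  forall x, (forall i, 0 < x ord0 i < 1) -> polyeval P x = 0.
Proof.
move=> int0 x x01; apply/eqP; apply: contraT => Px.
pose h y := polyeval P y * polyeval P y.
have hx : 0 < h x by rewrite /h -expr2 exprn_even_gt0.
have ch : {for x, continuous h} by apply: continuousM; exact: continuous_polyeval.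
have [e e0 eh] : exists2 e : R, 0 < e & forall y : euclid R n, (forall i,
  `|x ord0 i - y ord0 i| < e) -> h x / 2 < h y.
  have : nbhs x [set y : euclid R n | h x / 2 < h y].
    by apply: (ch [set r | h x / 2 < r]); apply: lt_nbhsr; lra.
  move=> /nbhs_ballP[e /= e0 eh]; exists e => // y xy; apply: eh; split => // i j.
  by rewrite (ord1 i); exact: xy.
(* Halving makes [d] strictly smaller than [e] and than the distance from [x] to every face, so the
   closed side of the box causes no trouble. *)
pose d := \big[Num.min/e]_i Num.min (x ord0 i) (1 - x ord0 i) / 2.
have d0 : 0 < d.
  rewrite divr_gt0//; apply: lt_bigmin => // i _; have /andP[x0 x1] := x01 i.
  by rewrite lt_min x0 subr_gt0.
have de : d < e.
  have : \big[Num.min/e]_i Num.min (x ord0 i) (1 - x ord0 i) <=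
    e by exact: bigmin_le_id.
  by move: d0; rewrite /d; lra.
have dx i : d < x ord0 i /\ d < 1 - x ord0 i.
  have : \big[Num.min/e]_i Num.min (x ord0 i) (1 - x ord0 i) <=
    Num.min (x ord0 i) (1 - x ord0 i).
    exact: bigmin_le_cond.
  by rewrite le_min => /andP[]; move: d0; rewrite /d; split; lra.
pose B : set (euclid R n) := box (x, x + const_mx d).
have BU : B `<=` U.
  move=> y By i; have /andP[] := By i; have [] := dx i; have /andP[] := x01 i.
  by rewrite in_itv/= !mxE; case: (b i); case: (c i) => /= *; apply/andP; split; lra.
have mB : measurable B.
  rewrite (_ : B = cube_at x d (fun=> false) (fun=> false)).
    by apply: measurable_cube; exact: cube_cube_at.
  by apply/seteqP; split => y By i; have := By i; rewrite /= in_itv/= !mxE.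
have mh D : measurable_fun D h by apply: measurable_funM; exact: measurable_polyeval.
have h0 y : 0 <= h y by rewrite /h -expr2 sqr_ge0.
have hi : mu.-integrable U (EFin \o h).
  by apply: integrable_polyevalM => //; exact: integrable_polyeval.
have : (\int[mu]_(y in U) (h y)%:E = 0)%E.
  have := integrable_fin_num mU hi; move: int0; rewrite /Rintegral -/h.
  by move=> h1 h2; rewrite -[LHS]fineK// h1.
suff : (0 < \int[mu]_(y in U) (h y)%:E)%E by move=> /[swap] ->; rewrite ltxx.
apply: (@lt_le_trans _ _ (\int[mu]_(y in B) (h x / 2)%:E)%E).
  by rewrite integral_cst// mule_gt0// ?lte_fin ?divr_gt0//; exact: box_measure_gt0.
apply: (@le_trans _ _ (\int[mu]_(y in B) (h y)%:E)%E).
  apply: ge0_le_integral => //.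
  - by move=> y _; rewrite lee_fin; lra.
  - exact/measurable_EFinP.
  - move=> y By; rewrite lee_fin ltW//; apply: eh => i.
    have /andP[] := By i; rewrite !mxE => h1 h2.
    by rewrite ltr_norml; apply/andP; split; lra.
apply: ge0_subset_integral => //.
- exact/measurable_EFinP.
- by move=> y _; rewrite lee_fin.
Qed.

End gram.

(** * Bounds for the projection *)

(** Reduction modulo [d] isolates the lowest digit; it is then cancelled and [d] divided out. *)
Lemma digits_inj (N d : nat) (u v : 'I_N -> nat) :
  (forall i, u i < d)%N -> (forall i, v i < d)%N ->
  (\sum_i u i * d ^ i = \sum_i v i * d ^ i)%N -> u =1 v.
Proof.
elim: N u v => [u v _ _ _ []//|N IH u v ud vd].
have d0 : (0 < d)%N by apply: leq_trans (ud ord0).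
have shift (w : 'I_N.+1 -> nat) : (\sum_i w i * d ^ i =
    w ord0 + d * \sum_(i < N) w (lift ord0 i) * d ^ i)%N.
  rewrite big_ord_recl muln1 big_distrr/=; congr addn; apply: eq_bigr => i _.
  by rewrite /bump /= add1n expnS mulnCA.
rewrite !shift => h.
have h0 : u ord0 = v ord0.
  have := congr1 (modn^~ d) h; rewrite -!(addnC (d * _)%N) !(mulnC d) !modnMDl.
  by rewrite !modn_small.
move: h; rewrite h0 => /addnI/eqP; rewrite eqn_pmul2l// => /eqP hs.
have := IH (u \o lift ord0) (v \o lift ord0) (fun i => ud _) (fun i => vd _) hs.
by move=> e i; case: (unliftP ord0 i) => [j ->|->//]; exact: e.
Qed.

Section projection_unit_cube.
Context (R : realType) (n s : nat).
Implicit Types (f : euclid R n -> R) (x : euclid R n) (b c : 'I_n.+1 -> bool).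
Notation mu := (@lebesgue R n).
Notation idx := (bmultinom n.+1 s.+1).

(* Kronecker substitution: along the curve x_j = t ^ (s.+1 ^ j), distinct
   monomials of degree at most s become distinct powers of t. *)
Lemma poly_of_row_eq0 (v : 'rV[R]_#|{: idx}|) :
  (forall x, (forall i, 0 < x ord0 i < 1) -> polyeval (poly_of_row v) x = 0) ->
  v = 0.
Proof.
(* [k i] is the power of [t] into which the monomial turns along the curve. Each exponent is at most
   [s], hence a digit in base [s.+1], which makes [k] injective. *)
move=> v0; pose k (i : 'I_#|{: idx}|) := (\sum_j (bmnm (enum_val i)) j * s.+1 ^ j)%N.
have k_inj : injective k.
  have ms (i : 'I_#|{: idx}|) j : (bmnm (enum_val i) j < s.+1)%N.
    by apply: leq_ltn_trans (bmdeg (enum_val i)); rewrite mdegE (bigD1 j)//= leq_addr.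
  by move=> i1 i2 /digits_inj e; apply/enum_val_inj/val_inj/mnmP => j; exact: e.
pose q : {poly R} := \sum_i v ord0 i *: 'X^(k i).
have q0 t : 0 < t < 1 -> q.[t] = 0.
  move=> /andP[t0 t1]; rewrite -(v0 (\row_j t ^+ (s.+1 ^ j))) => [|j]; last first.
    by rewrite mxE exprn_gt0// exprn_ilt1// ?ltW// -lt0n expn_gt0.
  rewrite polyeval_poly_of_row horner_sum; apply: eq_bigr => i _.
  rewrite hornerZ hornerXn; congr (_ * _); rewrite /monomial /k.
  rewrite (big_morph _ (exprD t) (expr0 t)); apply: eq_bigr => j _.
  by rewrite mxE mulnC exprM.
have qE : q = 0.
  (* The numbers [1 / (j + 2)] are distinct points of the open unit interval, and [size q] of them
     are more roots than the degree of a nonzero [q] allows. *)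
  apply: (@roots_geq_poly_eq0 _ _ [seq (j.+2%:R)^-1 | j <- iota 0 (size q)]).
  - apply/allP => _ /mapP[j _ ->]; apply/eqP; apply: q0.
    by rewrite invr_gt0 ltr0n/= invf_lt1 ?ltr0n// ltr1n.
  - rewrite map_inj_uniq ?iota_uniq// => i j /invr_inj/eqP.
    by rewrite eqr_nat => /eqP[].
  - by rewrite size_map size_iota.
apply/rowP => i; rewrite mxE.
have := congr1 (fun r : {poly R} => r`_(k i)) qE; rewrite coef0 coef_sum.
rewrite (bigD1 i)//= coefZ coefXn eqxx mulr1 big1 ?addr0// => j ji.
by rewrite coefZ coefXn (inj_eq k_inj) eq_sym (negbTE ji) mulr0.
Qed.

(** A vector in the kernel yields a projection of the zero function. Being orthogonal to itself,
    this polynomial has a square of integral 0. *)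
Lemma gram_unit b c : gram R s b c \in unitmx.
Proof.
rewrite -row_free_unit -kermx_eq0; apply/rowV0P => v /sub_kermxP vG.
apply: poly_of_row_eq0; apply: (polyeval_eq0_of_Rintegral (b := b) (c := c)).
have cU : cube (cube_at 0 1 b c : set (euclid R n)) by exact: cube_cube_at.
have P0 : is_polyproj s (cube_at 0 1 b c) (cst 0) (poly_of_row v).
  apply/is_polyproj_row; first exact: (integrable0 mu).
  rewrite vG; apply/rowP => j; rewrite !mxE.
  by under eq_Rintegral do rewrite mul0r; rewrite Rintegral_cst ?mul0r//;
    exact: measurable_cube.
have := is_polyprojP cU (integrable0 mu _) P0 (msize_poly_of_row v).
under eq_Rintegral do rewrite sub0r mulNr -mulN1r.
rewrite RintegralZl; [by move/eqP;
  rewrite mulN1r oppr_eq0 => /eqP|exact: measurable_cube|].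
by apply: integrable_polyevalM => //; exact: integrable_polyeval.
Qed.

Lemma monomial_le1 g x : (forall i, `|x ord0 i| <= 1) -> `|monomial g x| <= 1.
Proof.
move=> x1; rewrite normr_prod; apply: prodr_ile1 => i _.
by rewrite normr_ge0 normrX exprn_ile1.
Qed.

Lemma cube_at01_le1 b c x : cube_at 0 1 b c x -> forall i, `|x ord0 i| <= 1.
Proof.
move=> Ux i; have := Ux i; rewrite in_itv/= mxE add0r => /andP[/lteifW h1 /lteifW h2].
by rewrite ger0_norm.
Qed.

Lemma polyproj_unit_cube b c :
  exists2 K : R, 0 <= K & forall f, mu.-integrable (cube_at 0 1 b c) (EFin \o f) ->
    (exists P, is_polyproj s (cube_at 0 1 b c) f P) /\
    forall P, is_polyproj s (cube_at 0 1 b c) f P ->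
      forall x, cube_at 0 1 b c x ->
        `|polyeval P x| <= K * \int[mu]_(x in cube_at 0 1 b c) `|f x|.
Proof.
set U := cube_at 0 1 b c; have cU : cube U by exact: cube_cube_at.
have mU := measurable_cube cU; have Gu := gram_unit b c; set G := gram _ _ _ _ in Gu.
(* The coefficients of the projection are the moments times [invmx G]. Monomials are bounded by 1 on
   the unit cube, so each moment is at most the integral of [|f|]. *)
exists (\sum_i \sum_j `|invmx G j i|); first by do 2 apply: sumr_ge0 => ? _.
move=> f fU; split.
  exists (poly_of_row (moments s b c f *m invmx G)); apply/is_polyproj_row => //.
  by rewrite mulmxKV.
move=> P PP x Ux; have [Ps _] := PP; have [v Pv] := poly_of_row_surj Ps.
move: PP; rewrite Pv => /(is_polyproj_row _ fU) => /(congr1 (mulmx^~ (invmx G))).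
rewrite mulmxK// => ->; rewrite polyeval_poly_of_row mulr_suml.
apply: le_trans (ler_norm_sum _ _ _) _; apply: ler_sum => i _.
rewrite normrM -[leRHS]mulr1 ler_pM//; last by apply: monomial_le1;
  exact: cube_at01_le1 Ux.
rewrite mxE mulr_suml; apply: le_trans (ler_norm_sum _ _ _) _; apply: ler_sum => j _.
rewrite normrM mulrC ler_wpM2l// mxE.
have ifm : mu.-integrable U (EFin \o (fun x => f x * monomial (bmnm (enum_val j)) x)).
  by have := integrable_polyevalM (mpolyX R (bmnm (enum_val j))) cU fU;
    rewrite polyevalX.
apply: le_trans (le_normr_Rintegral mU ifm) _.
apply: le_Rintegral => //.
- exact: (integrable_norm ifm).
- exact: (integrable_norm fU).
- move=> y Uy; rewrite normrM -[leRHS]mulr1 ler_wpM2l//.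
  by apply: monomial_le1; exact: cube_at01_le1 Uy.
Qed.

End projection_unit_cube.

(** * The projection bound on an arbitrary cube *)

Section projection.
Context (R : realType) (n s : nat).
Implicit Types (f : euclid R n -> R) (x : euclid R n) (Q : set (euclid R n)).
Notation mu := (@lebesgue R n).

Lemma polyproj_cube :
  exists2 K : R, 0 <= K & forall Q f, cube Q -> mu.-integrable Q (EFin \o f) ->
    (exists P, is_polyproj s Q f P) /\
    forall P, is_polyproj s Q f P ->
      forall x, Q x -> `|polyeval P x| <=
        K * ((fine (mu Q))^-1 * \int[mu]_(x in Q) `|f x|).
Proof.
pose F := ({ffun 'I_n.+1 -> bool} * {ffun 'I_n.+1 -> bool})%type.
pose U (bc : F) : set (euclid R n) := cube_at 0 1 bc.1 bc.2.
pose bounds (bc : F) (K : R) := 0 <= K /\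
    forall f, mu.-integrable (U bc) (EFin \o f) ->
    (exists P, is_polyproj s (U bc) f P) /\
    forall P, is_polyproj s (U bc) f P ->
      forall x, U bc x -> `|polyeval P x| <= K * \int[mu]_(x in U bc) `|f x|.
have [K0 K0P] : {K : F -> R & forall bc, bounds bc (K bc)}.
  apply: (@choice _ _ bounds) => bc;
    have [K K0 KP] := polyproj_unit_cube R s bc.1 bc.2.
  by exists K.
have mU0 bc : 0 <= fine (mu (U bc)) by rewrite fine_ge0.
(* Summing over the endpoint patterns makes the constant independent of [Q]. The factor [mu (U bc)]
   turns the integral into a mean, as [l^-1 ^+ n.+1] is the quotient of [mu (U bc)] by [mu Q]. *)
exists (\sum_bc K0 bc * fine (mu (U bc))).
  by apply: sumr_ge0 => bc _; rewrite mulr_ge0// (K0P bc).1.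
move=> Q f cQ fQ; have [a [l [b [c [l0 QE]]]]] := cQ.
pose bc : F := (finfun b, finfun c).
have UE : affine a l @^-1` Q = U bc.
  rewrite QE -[X in _ @^-1` X]/(cube_at a l b c) preimage_affine_cube//.
  by congr (cube_at 0 1 _ _); apply/funext => i; rewrite ffunE.
have QT : affine (- (l^-1 *: a)) l^-1 @^-1` U bc = Q.
  rewrite -UE -comp_preimage (_ : _ \o _ = id) ?preimage_id//.
  by apply/funext => x /=; rewrite affineVK ?gt_eqF.
have mQ := measurable_cube cQ; have li : 0 < l^-1 by rewrite invr_gt0.
have cU : cube (U bc) by exact: cube_cube_at.
have fU := integrable_affine a l0 mQ fQ; rewrite UE in fU.
have [_ /(_ _ fU)[[P PP] Kbd]] := K0P bc; split.
  (* Existence is carried from the unit cube back to [Q] by the inverse affine map. *)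
  exists (affine_poly (- (l^-1 *: a)) l^-1 P).
  have := is_polyproj_affine (- (l^-1 *: a)) li cU fU PP; rewrite QT.
  by rewrite (_ : (f \o _) \o _ = f)//; apply/funext => x /=;
    rewrite affineVK ?gt_eqF.
move=> {PP}P PP x Qx.
have := is_polyproj_affine a l0 cQ fQ PP; rewrite UE => /Kbd.
move=> /(_ (affine (- (l^-1 *: a)) l^-1 x)).
rewrite -[U bc _]/((affine (- (l^-1 *: a)) l^-1 @^-1` U bc) x) QT => /(_ Qx).
rewrite polyeval_affine affineVK ?gt_eqF// => /le_trans; apply.
have muU : fine (mu (U bc)) = l^-1 ^+ n.+1 * fine (mu Q).
  rewrite (_ : mu (U bc) = ((l^-1 ^+ n.+1)%:E * mu Q)%E); last by rewrite -UE;
    exact: outer_affine.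
  by rewrite fineM// cube_measure_fin.
have Qgt0 : 0 < fine (mu Q).
  by rewrite fine_gt0// cube_measure_gt0// bounded_measure_lty//; exact: bounded_cube.
rewrite -UE (Rintegral_affine a l0 mQ (f := fun x => `|f x|));
  last exact: (integrable_norm fQ).
rewrite (_ : l^-1 ^+ n.+1 = fine (mu (U bc)) * (fine (mu Q))^-1);
  last by rewrite muU mulfK// gt_eqF.
rewrite [leLHS](_ : _ = K0 bc * fine (mu (U bc)) *
  ((fine (mu Q))^-1 * \int[mu]_(x in Q) `|f x|)); last by rewrite !mulrA.
rewrite ler_wpM2r ?mulr_ge0 ?Rintegral_ge0 ?invr_ge0 ?(ltW Qgt0)//.
rewrite (bigD1 bc)//= lerDl; apply: sumr_ge0 => ? _.
by rewrite mulr_ge0// (K0P _).1.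
Qed.

End projection.

(** * Means *)

Section powers.
Context (R : realType).
Local Open Scope ereal_scope.
Implicit Types (x y : \bar R) (r : R).

Lemma le_poweR r x y : (0 <= r)%R -> 0 <= x -> x <= y -> x `^ r <= y `^ r.
Proof.
move=> r0 x0 xy; apply: gt0_ler_poweR => //; rewrite in_itv/= leey andbT//.
exact: le_trans xy.
Qed.

(** A sum is at most twice its larger term; this also covers infinite values. *)
Lemma poweR_addr_le r x y : (0 <= r)%R -> 0 <= x -> 0 <= y ->
  (x + y) `^ r <= (2 `^ r)%:E * (x `^ r + y `^ r).
Proof.
move=> r0; wlog xy : x y / x <= y => [W|x0 y0].
  by have [/W//|/ltW yx x0 y0] := leP x y; rewrite addeC (addeC (x `^ r)); exact: W.
apply: (@le_trans _ _ ((2%:E * y) `^ r)).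
  by apply: le_poweR; rewrite ?adde_ge0// mule_natl mule2n leeD2r.
rewrite poweRM// ?lee_fin// lee_pmul2l ?lte_fin ?powR_gt0//.
by rewrite leeDr// poweR_ge0.
Qed.

Lemma poweRV_addr_le r x y : (1 <= r)%R -> 0 <= x -> 0 <= y ->
  (x + y) `^ r^-1 <= 2%:E * (x `^ r^-1 + y `^ r^-1).
Proof.
move=> r1 x0 y0; have r0 : (0 < r)%R by exact: lt_le_trans r1.
apply: le_trans (poweR_addr_le _ x0 y0) _; first by rewrite invr_ge0 ltW.
apply: lee_wpmul2r; first by rewrite adde_ge0// poweR_ge0.
by rewrite lee_fin ler1_powR// ?ler1n// invf_le1.
Qed.

Lemma poweRrK r x : (r != 0)%R -> 0 <= x -> (x `^ r) `^ r^-1 = x.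
Proof. by move=> r0 x0; rewrite -poweRrM mulfV// poweRe1. Qed.

Lemma poweRVrK r x : (r != 0)%R -> 0 <= x -> (x `^ r^-1) `^ r = x.
Proof. by move=> r0 x0; rewrite -poweRrM mulVf// poweRe1. Qed.

(** The 4 is a product: one 2 is the root of [2 ^ r], the other comes from splitting the root of the
    sum by [poweRV_addr_le]. *)
Lemma poweRV_le_add r x y (M : R) : (1 <= r)%R -> (0 <= M)%R -> 0 <= x -> 0 <= y ->
  x <= (2 `^ r)%:E * (y + M%:E `^ r) -> x `^ r^-1 <= 4%:E * (y `^ r^-1 + M%:E).
Proof.
move=> r1 M0 x0 y0 xy; have r0 : (0 < r)%R by exact: lt_le_trans r1.
have ri0 : (0 <= r^-1)%R by rewrite invr_ge0 ltW.
have Mr0 : 0 <= M%:E `^ r by exact: poweR_ge0.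
apply: le_trans (le_poweR ri0 x0 xy) _.
rewrite poweRM ?lee_fin ?powR_ge0 ?adde_ge0//.
rewrite -[X in X `^ r^-1 * _]poweR_EFin poweRrK ?gt_eqF ?lee_fin//.
have -> : 4%:E = 2%:E * 2%:E :> \bar R by rewrite -EFinM; congr (_%:E); lra.
rewrite -muleA lee_wpmul2l ?lee_fin//.
apply: le_trans (poweRV_addr_le r1 y0 Mr0) _.
by rewrite poweRrK ?gt_eqF ?lee_fin.
Qed.

End powers.

Section mean.
Context d (T : measurableType d) (R : realType) (mu : {measure set T -> \bar R}).
Implicit Types (h : T -> R) (Q : set T) (q : \bar R).
Local Open Scope ereal_scope.

(** [qmean] over an arbitrary measure, convertible to it for [lebesgue]. *)
Definition mean q Q h : \bar R :=
  match q with
  | q%:E => poweR ((fine (mu Q))^-1%:E *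
      \int[mu]_(x in Q) (`|h x| `^ q)%:E) q^-1
  | +oo => ess_sup mu (fun x => (`|h x| * \1_Q x)%:E)
  | -oo => 0
  end.

Let mu_setT_gt0 Q : measurable Q -> 0 < mu Q -> 0 < mu setT.
Proof. by move=> mQ /lt_le_trans; apply; apply: le_measure; rewrite ?inE. Qed.

Let fine_gt0' Q : 0 < mu Q -> mu Q < +oo -> (0 < fine (mu Q))%R.
Proof. by move=> Q0 Qoo; rewrite fine_gt0// Q0. Qed.

Lemma mean_ge0 q Q h : measurable Q -> 0 < mu Q -> 1 <= q -> 0 <= mean q Q h.
Proof.
move=> mQ Q0; case: q => [r _| _|//]; first exact: poweR_ge0.
apply: ess_sup_gee => //; first exact: mu_setT_gt0 Q0.
by apply: nearW => x; rewrite lee_fin mulr_ge0.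
Qed.

Let measurable_normr_powR (r : R) Q h : measurable_fun Q h ->
  measurable_fun Q (fun x => (`|h x| `^ r)%:E).
Proof.
move=> mh; apply/measurable_EFinP; apply: (measurableT_comp (measurable_powR r)).
exact: measurableT_comp.
Qed.

(** For finite [q] the pointwise bound is raised to the power [q] and averaged, the mean of the
    constant [M ^ q] being [M ^ q]. For [q = +oo] the essential suprema compare even without the
    factor 4. *)
Lemma mean_le_add q Q h h' (M : R) : 1 <= q -> measurable Q -> 0 < mu Q ->
  mu Q < +oo ->
  measurable_fun Q h -> measurable_fun Q h' -> (0 <= M)%R ->
  (forall x, Q x -> `|h x| <= `|h' x| + M)%R ->
  mean q Q h <= 4%:E * (mean q Q h' + M%:E).
Proof.
move=> q1 mQ Q0 Qoo mh mh' M0 hh'.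
have muQ : mu Q = (fine (mu Q))%:E by rewrite fineK// ge0_fin_numE.
have fQ := fine_gt0' Q0 Qoo.
have := mean_ge0 h' mQ Q0 q1; case: q q1 => [r r1|_|//] h'0.
- rewrite lee_fin in r1; have r0 : (0 < r)%R by exact: lt_le_trans r1.
  rewrite /mean; set w := (fine (mu Q))^-1%:E.
  have w0 : 0 <= w by rewrite lee_fin invr_ge0 ltW.
  set A := \int[mu]_(x in Q) (`|h x| `^ r)%:E;
    set A' := \int[mu]_(x in Q) (`|h' x| `^ r)%:E.
  have A'0 : 0 <= A' by apply: integral_ge0 => x _; rewrite lee_fin powR_ge0.
  have AA' : A <= (2 `^ r)%:E * (A' + (M `^ r)%:E * mu Q).
    rewrite -(integral_cst _ mQ) /A' -ge0_integralD//;
      try exact: measurable_normr_powR;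
      try by move=> x _; rewrite lee_fin powR_ge0.
    rewrite -ge0_integralZl//; first last.
    - by move=> x _; rewrite adde_ge0// lee_fin powR_ge0.
    - by apply: emeasurable_funD => //; exact: measurable_normr_powR.
    apply: ge0_le_integral => //; first exact: measurable_normr_powR.
    - by apply: measurable_funeM; apply: emeasurable_funD => //;
      exact: measurable_normr_powR.
    - move=> x Qx; rewrite -!poweR_EFin.
      apply: le_trans (poweR_addr_le (ltW r0) _ _); rewrite ?lee_fin//.
      by apply: ge0_ler_powR; rewrite ?nnegrE ?addr_ge0 ?(ltW r0)//; exact: hh'.
  have wA : w * A <= (2 `^ r)%:E * (w * A' + M%:E `^ r).
    apply: le_trans (lee_wpmul2l w0 AA') _; rewrite muleCA ge0_muleDr//; last first.
      by rewrite mule_ge0// lee_fin powR_ge0.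
    rewrite muQ -!EFinM mulrCA mulVf ?mulr1 ?poweR_EFin//.
    by rewrite gt_eqF.
  have A0 : 0 <= A by apply: integral_ge0 => x _; rewrite lee_fin powR_ge0.
  exact: (poweRV_le_add r1 M0 (mule_ge0 w0 A0) (mule_ge0 w0 A'0) wA).
- rewrite /mean in h'0 *; set S := ess_sup mu (fun x =>
  (`|h' x| * \1_Q x)%:E) in h'0 *.
  apply: (@le_trans _ _ (S + M%:E)); last first.
    by rewrite lee_pemull ?lee_fin ?ler1n// adde_ge0.
  apply/ess_supP; have := ess_sup_ge mu (fun x => (`|h' x| * \1_Q x)%:E).
  apply: filterS => x; rewrite -/S => h'S.
  apply: (@le_trans _ _ ((`|h' x| * \1_Q x)%:E + M%:E)); last exact: leeD2r.
  rewrite -EFinD lee_fin indicE; case: (boolP (x \in Q)) => [/set_mem Qx|_].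
    by rewrite !mulr1 hh'.
  by rewrite !mulr0 add0r.
Qed.

(** Either [a <= t], or [a / t >= 1] and then [a / t] is at most its [r]-th power. The second
    summand is [t] times that power. *)
Lemma young_le (r a t : R) : (1 <= r)%R -> (0 <= a)%R -> (0 < t)%R ->
  (a <= t + t / t `^ r * a `^ r)%R.
Proof.
move=> r1 a0 t0; have [at_|ta] := leP a t.
  by rewrite (le_trans at_)// lerDl mulr_ge0 ?powR_ge0// divr_ge0 ?powR_ge0// ltW.
have at1 : (1 <= a / t)%R by rewrite ler_pdivlMr// mul1r ltW.
have := le1r_powR at1 r1; rewrite ler_pdivrMr// => /le_trans; apply.
have -> : ((a / t) `^ r = a `^ r / t `^ r)%R.
  by rewrite powRM ?invr_ge0 ?(ltW t0)// -powR_inv1 ?(ltW t0)// -powRrM mulN1r powRN.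
by rewrite (_ : t / t `^ r * a `^ r = a `^ r / t `^ r * t)%R ?lerDr ?ltW//; ring.
Qed.

Lemma mean1E Q h : mean 1 Q h = (fine (mu Q))^-1%:E * \int[mu]_(x in Q) (`|h x|)%:E.
Proof.
rewrite /mean invr1 poweRe1.
  by congr (_ * _); apply: eq_integral => x _; rewrite powRr1.
by rewrite mule_ge0 ?integral_ge0 ?lee_fin ?invr_ge0 ?fine_ge0.
Qed.

Lemma mean1_le q Q h : 1 <= q -> measurable Q -> 0 < mu Q -> mu Q < +oo ->
  measurable_fun Q h ->
  mean 1 Q h <= 2%:E * mean q Q h.
Proof.
move=> q1 mQ Q0 Qoo mh.
have muQ : mu Q = (fine (mu Q))%:E by rewrite fineK// ge0_fin_numE.
have fQ := fine_gt0' Q0 Qoo.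
have w0 : 0 <= (fine (mu Q))^-1%:E by rewrite lee_fin invr_ge0 ltW.
have wmu : (fine (mu Q))^-1%:E * mu Q = 1.
  by rewrite {2}muQ -EFinM mulVf// gt_eqF.
have mnh : measurable_fun Q (fun x => (`|h x|)%:E).
  by apply/measurable_EFinP; exact: measurableT_comp.
have := mean_ge0 h mQ Q0 q1; rewrite mean1E; set M := mean q Q h => M0.
have : M < +oo \/ M = +oo by case: (ltP M +oo); [left|rewrite leye_eq => /eqP; right].
case=> [Moo|->]; last by rewrite gt0_muley ?leey.
have Mfin : M \is a fin_num by rewrite ge0_fin_numE.
case: q q1 @M M0 Moo Mfin => [r r1|_|//] M M0 Moo Mfin.
- rewrite lee_fin in r1; have r0 : (0 < r)%R by exact: lt_le_trans r1.
  (* [young_le] is averaged at a level [t] above the [q]-mean, where both summands have mean at most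
     [t]. The margin [e / 2] keeps [t] positive when the [q]-mean is 0. *)
  apply/lee_addgt0Pr => e e0; pose t := (fine M + e / 2)%R.
  have t0 : (0 < t)%R by rewrite /t; have := fine_ge0 M0; lra.
  have MtE : 2%:E * M + e%:E = (2 * t)%:E.
    by rewrite -(fineK Mfin) -EFinM -EFinD /t; congr (_%:E); lra.
  pose A := \int[mu]_(x in Q) (`|h x| `^ r)%:E.
  have A0 : 0 <= A by apply: integral_ge0 => x _; rewrite lee_fin powR_ge0.
  have wAt : (fine (mu Q))^-1%:E * A <= (t `^ r)%:E.
    rewrite -[leLHS](@poweRVrK _ r) ?gt_eqF ?mule_ge0// -[X in X `^ r]/M.
    rewrite -poweR_EFin; apply: le_poweR => //; first exact: ltW.
    by rewrite -(fineK Mfin) lee_fin /t; lra.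
  have c0 : (0 <= t / t `^ r)%R by rewrite divr_ge0 ?powR_ge0// ltW.
  apply: (@le_trans _ _ ((fine (mu Q))^-1%:E * (t%:E * mu Q + (t / t `^ r)%:E * A))).
    apply: lee_wpmul2l => //.
    rewrite -(integral_cst _ mQ) -ge0_integralZl//; last exact: measurable_normr_powR.
    rewrite -ge0_integralD//; first last.
    - by apply: measurable_funeM; exact: measurable_normr_powR.
    - by move=> x _; rewrite mule_ge0// lee_fin powR_ge0.
    - by move=> x _; rewrite lee_fin ltW.
    apply: ge0_le_integral => //.
    - apply: emeasurable_funD => //.
      by apply: measurable_funeM; exact: measurable_normr_powR.
    - by move=> x _; rewrite -EFinM -EFinD lee_fin; exact: young_le.
  rewrite ge0_muleDr ?mule_ge0 ?lee_fin ?(ltW t0)// muleCA wmu mule1 muleCA MtE.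
  apply: (@le_trans _ _ (t%:E + (t / t `^ r)%:E * (t `^ r)%:E)).
    by rewrite leeD2l// lee_wpmul2l.
  by rewrite -EFinM -EFinD lee_fin divfK ?gt_eqF ?powR_gt0//; lra.
- apply: (@le_trans _ _ ((fine (mu Q))^-1%:E * (M * mu Q))).
    apply: lee_wpmul2l => //; rewrite -(integral_cst _ mQ).
    apply: ae_ge0_le_integral => //.
    have := ess_sup_ge mu (fun x => (`|h x| * \1_Q x)%:E).
    apply: filterS => x; rewrite -[X in _ <= X]/M => hM Qx.
    by move: hM; rewrite indicE mem_set// mulr1.
  by rewrite muleCA wmu mule1 lee_pemull// lee_fin ler1n.
Qed.

End mean.

(** * Comparison of the norms *)

Section finite_norms.
Context d (T : measurableType d) (R : realType) (mu : {measure set T -> \bar R}).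
Implicit Types (f h : T -> R) (E : set T) (q : \bar R).
Local Open Scope ereal_scope.

Lemma integral_normr_powR_indic (r : R) E h : (0 < r)%R ->
  \int[mu]_x (`|(h x * \1_E x)%:E| `^ r) = \int[mu]_(x in E) (`|h x| `^ r)%:E.
Proof.
move=> r0; rewrite [RHS]integral_mkcond; apply: eq_integral => x _.
rewrite /patch indicE; case: ifPn => xE /=; first by rewrite mulr1.
by rewrite mulr0 normr0 powR0// gt_eqF.
Qed.

(** For finite [q], [young_le] at [t = 1] gives [|f| <= 1 + |f| ^ q], integrable because [E] has
    finite measure; for [q = +oo], [f] is essentially bounded on [E]. *)
Lemma finite_norm_integrable q E f : 1 <= q -> 0 < mu setT -> measurable E ->
  mu E < +oo -> measurable_fun E f ->
  finite_norm mu q (fun x => f x * \1_E x)%R -> mu.-integrable E (EFin \o f).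
Proof.
move=> q1 T0 mE Eoo mf; rewrite /finite_norm unlock => fin.
have mnf : measurable_fun E (fun x => `|f x|%:E).
  by apply/measurable_EFinP; exact: measurableT_comp.
apply/integrableP; split; first exact/measurable_EFinP.
case: q q1 fin => [r r1 fin|_|//].
- rewrite lee_fin in r1; have r0 : (0 < r)%R by exact: lt_le_trans r1.
  have {}fin := lty_poweRy (invr_neq0 (lt0r_neq0 r0)) fin.
  rewrite /= integral_normr_powR_indic// in fin.
  have mfr : measurable_fun E (fun x => (`|f x| `^ r)%:E).
    apply/measurable_EFinP; apply: (measurableT_comp (measurable_powR r)).
    exact: measurableT_comp.
  apply: (@le_lt_trans _ _ (\int[mu]_(x in E) (1%:E + (`|f x| `^ r)%:E))).
    apply: ge0_le_integral => //; first exact: emeasurable_funD.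
    move=> x _; rewrite /= -EFinD lee_fin.
    by have := young_le r1 (normr_ge0 (f x)) ltr01; rewrite powR1 divr1 mul1r.
  rewrite ge0_integralD//; first by rewrite integral_cst// mul1e lte_add_pinfty.
- rewrite T0 => fin; set S := ess_sup _ _ in fin.
  have S0 : 0 <= S by apply: ess_sup_gee => //; apply: nearW => x; exact: abse_ge0.
  apply: (@le_lt_trans _ _ (\int[mu]_(x in E) S)); last first.
    by rewrite integral_cst// lte_mul_pinfty// ge0_fin_numE.
  apply: ae_ge0_le_integral => //.
  have := ess_sup_ge mu (abse \o (EFin \o (fun x => f x * \1_E x)%R)).
  by apply: filterS => x /= fS Ex; move: fS; rewrite indicE mem_set// mulr1.
Qed.

Lemma integrable_finite_norm1 E f h : measurable E -> measurable_fun E h ->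
  mu.-integrable E (EFin \o f) -> (forall x, (`|h x| <= `|f x|)%R) ->
  finite_norm mu 1 (fun x => h x * \1_E x)%R.
Proof.
move=> mE mh fE hf; rewrite /finite_norm unlock invr1 poweRe1;
  last by apply: integral_ge0 => x _; exact: poweR_ge0.
rewrite /= integral_normr_powR_indic//.
have [mf ioo] := integrableP _ _ _ fE; apply: le_lt_trans ioo.
under eq_integral do rewrite powRr1//.
apply: ge0_le_integral => //.
- by apply/measurable_EFinP; exact: measurableT_comp.
- exact: measurableT_comp.
- by move=> x _; rewrite lee_fin.
Qed.

End finite_norms.

(** * From estimates on single cubes to the norms *)

Section Nnorm_comparison.
Context (R : realType) (n : nat).
Implicit Types (X Q : set (euclid R n)) (g : set (euclid R n) -> \bar R).
Local Open Scope ereal_scope.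

Lemma esumZl_le (I : choiceType) (D : set I) (a : I -> \bar R) (c : R) :
  (0 <= c)%R -> (forall i, 0 <= a i) ->
  \esum_(i in D) (c%:E * a i) <= c%:E * \esum_(i in D) a i.
Proof.
move=> c0 a0; apply: ge_ereal_sup => _ [A [fA AD] <-].
rewrite -ge0_mule_fsumr//.
by apply: lee_wpmul2l; [rewrite lee_fin|apply: esum_ge; exists A].
Qed.

Lemma Nnorm_ge0 p alpha X g : 1 <= p -> X = setT \/ cube X ->
  (forall Q, cube Q -> Q `<=` X -> 0 <= g Q) -> 0 <= Nnorm p alpha X g.
Proof.
case: p => [r _ _ _| _ XX g0|//]; first exact: poweR_ge0.
(* For [p = +oo] the supremum must range over at least one cube, as an empty supremum is [-oo]. *)
have [Q [cQ QX]] : exists Q, cube Q /\ Q `<=` X.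
  case: XX => [->|cX]; last by exists X; split.
  exists (cube_at 0%R 1%R (fun=> true) (fun=> true)); split => //.
  exact: cube_cube_at.
apply: ereal_sup_ge => /=; exists (poweR (lebesgue Q) (- alpha) * g Q).
  by exists Q.
by rewrite mule_ge0 ?poweR_ge0 ?g0.
Qed.

(** For finite [p], the [p]-th powers of the terms lose a factor [(2 * K) ^ p], which survives sums
    and suprema. The final root gives [2 * K] and splits the sum at the cost of another 2. *)
Lemma Nnorm_le_add p alpha X g g1 g2 (K : R) : 1 <= p -> X = setT \/ cube X ->
  (0 <= K)%R ->
  (forall Q, cube Q -> Q `<=` X ->
    [/\ 0 <= g Q, 0 <= g1 Q, 0 <= g2 Q & g Q <= K%:E * (g1 Q + g2 Q)]) ->
  Nnorm p alpha X g <= (4 * K)%:E * (Nnorm p alpha X g1 + Nnorm p alpha X g2).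
Proof.
move=> p1 XX K0 H.
have N10 := Nnorm_ge0 alpha p1 XX (fun Q cQ QX => let: And4 _ h _ _ :=
  H Q cQ QX in h).
have N20 := Nnorm_ge0 alpha p1 XX (fun Q cQ QX => let: And4 _ _ h _ :=
  H Q cQ QX in h).
have wle Q : cube Q -> Q `<=` X -> poweR (lebesgue Q) (- alpha) * g Q <=
    K%:E * (poweR (lebesgue Q) (- alpha) * g1 Q + poweR (lebesgue Q) (- alpha) *
      g2 Q).
  move=> cQ QX; have [h0 h1 h2 hK] := H Q cQ QX.
  by rewrite -ge0_muleDr// muleCA lee_wpmul2l// poweR_ge0.
case: p p1 N10 N20 => [r r1 N10 N20|_ N10 N20|//]; last first.
  apply: ge_ereal_sup => _ [Q [cQ QX] <-]; apply: le_trans (wle Q cQ QX) _.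
  have [h0 h1 h2 hK] := H Q cQ QX.
  apply: lee_pmul; rewrite ?lee_fin ?adde_ge0 ?mule_ge0 ?poweR_ge0//; first by lra.
  by apply: leeD; apply: ereal_sup_ubound; exists Q.
rewrite lee_fin in r1; have r0 : (0 < r)%R by exact: lt_le_trans r1.
have ri0 : (0 <= r^-1)%R by rewrite invr_ge0 ltW.
pose term g Q := lebesgue Q * poweR (poweR (lebesgue Q) (- alpha) * g Q) r.
have t0 h Q : 0 <= term h Q by rewrite mule_ge0 ?poweR_ge0//;
  exact: lebesgue_outer_ge0.
pose S g := ereal_sup [set \esum_(Q in C) term g Q | C in collection X].
have S0 h : 0 <= S h.
  apply: ereal_sup_ge; exists 0 => //; exists set0; last exact: esum_set0.
  by split => //; exact: trivIset_set0.
have tle Q : cube Q -> Q `<=` X ->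
    term g Q <= ((2 * K) `^ r)%:E * (term g1 Q + term g2 Q).
  move=> cQ QX; have [h0 h1 h2 hK] := H Q cQ QX.
  rewrite /term -ge0_muleDr ?poweR_ge0// muleCA lee_wpmul2l//.
  apply: le_trans (le_poweR (ltW r0) _ (wle Q cQ QX)) _;
    first by rewrite mule_ge0// poweR_ge0.
  rewrite poweRM ?lee_fin ?adde_ge0 ?mule_ge0 ?poweR_ge0//.
  rewrite powRM// mulrC EFinM -muleA -poweR_EFin lee_wpmul2l ?poweR_ge0//.
  by apply: poweR_addr_le; rewrite ?(ltW r0)// mule_ge0// poweR_ge0.
have Sle : S g <= ((2 * K) `^ r)%:E * (S g1 + S g2).
  apply: ge_ereal_sup => _ [C CX <-].
  apply: (@le_trans _ _ (\esum_(Q in C) (((2 * K) `^ r)%:E * (term g1 Q + term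
    g2 Q)))).
    by apply: le_esum => Q CQ; have [cQ QX] := CX.1 Q CQ; exact: tle.
  have t12 Q : 0 <= term g1 Q + term g2 Q by rewrite adde_ge0.
  apply: le_trans (esumZl_le C (powR_ge0 _ _) t12) _.
  rewrite lee_wpmul2l ?lee_fin ?powR_ge0// esumD//.
  by apply: leeD; apply: ereal_sup_ubound; exists C.
rewrite /Nnorm -/(S g) -/(S g1) -/(S g2).
apply: le_trans (le_poweR ri0 (S0 g) Sle) _.
rewrite poweRM ?lee_fin ?powR_ge0 ?adde_ge0//.
rewrite -[X in X `^ r^-1 * _]poweR_EFin poweRrK ?gt_eqF ?lee_fin ?mulr_ge0//.
have -> : (4 * K)%:E = (2 * K)%:E * 2%:E :> \bar R by rewrite -EFinM;
  congr (_%:E); lra.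
rewrite -muleA lee_wpmul2l ?lee_fin ?mulr_ge0//.
exact: poweRV_addr_le.
Qed.

End Nnorm_comparison.

(** * Estimates on a cube *)

Section cube_comparison.
Context (R : realType) (n s : nat).
Implicit Types (f h : euclid R n -> R) (Q X : set (euclid R n)) (q : \bar R).
Notation mu := (@lebesgue R n).

Lemma is_polyprojB Q f h P P' : cube Q -> mu.-integrable Q (EFin \o f) ->
  mu.-integrable Q (EFin \o h) -> is_polyproj s Q f P -> is_polyproj s Q h P' ->
  is_polyproj s Q (fun x => f x - h x) (P - P').
Proof.
move=> cQ fQ hQ [Ps fP] [P's hP']; have mQ := measurable_cube cQ.
have iD k V g : mu.-integrable Q (EFin \o k) ->
    mu.-integrable Q (EFin \o (fun x => (k x - polyeval V x) * monomial g x)).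
  move=> ik; have := @integrable_polyevalM R n Q (fun x =>
    k x - polyeval V x) (mpolyX R g) cQ.
  rewrite polyevalX; apply.
  exact: integrable_sub_polyeval.
split.
  by apply: leq_trans (msizeD_le _ _) _; rewrite geq_max Ps msizeN.
move=> g gs; rewrite (@eq_Rintegral _ _ R mu Q (fun x =>
  (f x - polyeval P x) * monomial g x -
    (h x - polyeval P' x) * monomial g x)).
  by rewrite RintegralB ?fP ?hP' ?subrr//; exact: iD.
by move=> x _; rewrite /polyeval mevalB; ring.
Qed.

Lemma is_polyproj_polyeval Q P : (msize P <= s.+1)%N ->
  is_polyproj s Q (polyeval P) P.
Proof.
move=> Ps; split=> // g _; rewrite (@eq_Rintegral _ _ R mu Q (cst 0)); last first.
  by move=> x _; rewrite subrr mul0r.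
by rewrite /Rintegral integral0.
Qed.

Lemma qmean_mean q Q h : qmean q Q h = mean mu q Q h.
Proof. by []. Qed.

(** The 4 comes from [mean_le_add], and the 2 before [A] from [|f| - f = 2 f^-]. *)
Let arith_add (K A : R) (G N : \bar R) : 0 <= K -> (0 <= G)%E -> (0 <= N)%E ->
  A%:E = N -> (4%:E * (G + (K * (2 * A))%:E) <= (4 * (1 + 2 * K))%:E * (G + N))%E.
Proof.
move=> K0 G0 N0 AN; rewrite mulrA [in leLHS]EFinM AN [in leRHS]EFinM -muleA.
apply: lee_wpmul2l; rewrite ?lee_fin// ge0_muleDr//; apply: leeD.
  by rewrite lee_pemull// lee_fin; lra.
by apply: lee_wpmul2r => //; rewrite lee_fin; lra.
Qed.

(** Here the 2 in the hypothesis is the loss in [mean1_le]. *)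
Let arith_self (K B : R) (H : \bar R) : 0 <= K -> (0 <= H)%E -> (B%:E <=
  2%:E * H)%E ->
  (4%:E * (H + (K * B)%:E) <= (4 * (1 + 2 * K))%:E * H)%E.
Proof.
move=> K0 H0 BH; rewrite [in leRHS]EFinM -muleA.
apply: lee_wpmul2l; rewrite ?lee_fin// EFinD ge0_muleDl ?lee_fin ?mulr_ge0//.
rewrite mul1e leeD2l// (mulrC 2) !EFinM -muleA.
by apply: lee_wpmul2l; rewrite ?lee_fin.
Qed.

Lemma cube_comparison : exists2 K : R, 0 <= K & forall q Q f, (1 <= q)%E -> cube Q ->
  mu.-integrable Q (EFin \o f) ->
  let G := qmean q Q (fun x => f x - polyeval (polyproj s Q f) x) in
  let H := qmean q Q (fun x => f x - polyeval (polyproj s Q (fun y => `|f y|)) x) in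
  let N := qmean 1%E Q (f^\-) in
  [/\ H <= K%:E * (G + N), G <= K%:E * H & N <= H]%E.
Proof.
have [K K0 KP] := polyproj_cube R n s.
exists (4 * (1 + 2 * K)); first lra.
move=> q Q f q1 cQ fQ G H N.
have mQ := measurable_cube cQ; have Q0 := cube_measure_gt0 cQ.
have Qoo : (mu Q < +oo)%E by apply: bounded_measure_lty; exact: bounded_cube.
have mf : measurable_fun Q f by apply/measurable_EFinP; exact: measurable_int fQ.
pose P1 := polyproj s Q f; pose P2 := polyproj s Q (fun y => `|f y|).
have afQ : mu.-integrable Q (EFin \o (fun y =>
  `|f y|)) by exact: (integrable_norm fQ).
have P1P : is_polyproj s Q f P1 by apply: xgetPex; exact: (KP Q f cQ fQ).1.
have P2P : is_polyproj s Q (fun y => `|f y|) P2 by apply: xgetPex;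
  exact: (KP Q _ cQ afQ).1.
have meanE h : mu.-integrable Q (EFin \o h) ->
    ((fine (mu Q))^-1 * \int[mu]_(x in Q) `|h x|)%:E = qmean 1%E Q h.
  move=> hQ; rewrite qmean_mean mean1E EFinM; congr (_ * _)%E; rewrite fineK//.
  exact: (integrable_fin_num mQ (integrable_norm hQ)).
have fP2 : mu.-integrable Q (EFin \o (fun x => f x - polyeval P2 x)).
  exact: integrable_sub_polyeval.
have mfP P : measurable_fun Q (fun x => f x - polyeval P x).
  by apply: measurable_funB => //; exact: measurable_polyeval.
have G0 : (0 <= G)%E by exact: mean_ge0.
have H0 : (0 <= H)%E by exact: mean_ge0.
have NfQ : mu.-integrable Q (EFin \o f^\-) by exact: integrable_funrneg.
have N0 : (0 <= N)%E := @mean_ge0 _ _ _ mu 1%E Q (f^\-) mQ Q0 (lexx _).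
have negE x : `|f x| - f x = 2 * f^\- x.
  rewrite /funrneg; have [f0|f0] := leP 0 (f x).
    by rewrite ger0_norm// subrr max_r ?mulr0//; lra.
  by rewrite ltr0_norm// max_l; lra.
have mean1H : (qmean 1%E Q (fun x => f x - polyeval P2 x)%R <= 2%:E * H)%E.
  by apply: mean1_le.
pose w := (fine (mu Q))^-1.
have w0 : 0 <= w by rewrite invr_ge0 fine_ge0.
pose A := w * \int[mu]_(x in Q) `|f^\- x|.
pose B := w * \int[mu]_(x in Q) `|f x - polyeval P2 x|.
have AN : A%:E = N by exact: meanE.
have BE : B%:E = qmean 1%E Q (fun x => f x - polyeval P2 x) by exact: meanE.
have A0 : 0 <= A by rewrite mulr_ge0// Rintegral_ge0.
have B0 : 0 <= B by rewrite mulr_ge0// Rintegral_ge0.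
have int2A : w * \int[mu]_(x in Q) `| `|f x| - f x| = 2 * A.
  rewrite mulrCA.
  have <- : \int[mu]_(x in Q) (2 * `|f^\- x|) = 2 * \int[mu]_(x in Q) `|f^\- x|.
    by rewrite RintegralZl//; exact: (integrable_norm NfQ).
  by congr (_ * _); apply: eq_Rintegral => x _; rewrite negE normrM ger0_norm.
have sub_le P P' (M : R) x : `|polyeval (P' - P) x| <= M ->
    `|f x - polyeval P' x| <= `|f x - polyeval P x| + M.
  rewrite /polyeval mevalB => PM; apply: le_trans (lerD (lexx _) PM).
  set a := meval _ P; set a' := meval _ P'.
  by rewrite (_ : f x - a' = (f x - a) - (a' - a)) ?ler_normB//; ring.
split.
- have [_ /(_ _ (is_polyprojB cQ afQ fQ P2P P1P)) bd] := KP Q (fun x =>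
  `|f x| - f x) cQ
    (integrableB mQ afQ fQ).
  rewrite -/w int2A in bd.
  have KA0 : 0 <= K * (2 * A) by apply: mulr_ge0 => //; exact: mulr_ge0.
  have := mean_le_add q1 mQ Q0 Qoo (mfP P2) (mfP P1) KA0 (fun x Qx =>
    sub_le _ _ _ _ (bd x Qx)).
  by move=> /le_trans; apply; exact: (arith_add K0 G0 N0 AN).
(* As [P2] is a projection of itself, [P1 - P2] is one of [f - P2], and the projection bound applies
   to it. *)
- have P2' : is_polyproj s Q (polyeval P2) P2 by apply: is_polyproj_polyeval;
  exact: P2P.1.
  have := is_polyprojB cQ fQ (integrable_polyeval P2 cQ) P1P P2'.
  have [_ /[apply] bd] := KP Q _ cQ fP2.
  have KB0 : 0 <= K * B by exact: mulr_ge0.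
  have := mean_le_add q1 mQ Q0 Qoo (mfP P1) (mfP P2) KB0 (fun x Qx =>
    sub_le _ _ _ _ (bd x Qx)).
  have B2H : (B%:E <= 2%:E * H)%E by rewrite BE.
  by move=> /le_trans; apply; exact: (arith_self K0 H0 B2H).
(* Testing [|f| - P2] against the monomial of degree 0 shows that its integral vanishes, so [|f|]
   may be replaced by [P2] under the integral. *)
- have AB : 2 * A <= B.
    rewrite -int2A; apply: ler_wpM2l => //.
    have bQ : mu.-integrable Q (EFin \o (fun x => polyeval P2 x - f x)).
      by apply: (@integrableB _ _ _ mu Q _ (EFin \o polyeval P2) (EFin \o f)) =>
        //; exact: integrable_polyeval.
    have aQ : mu.-integrable Q (EFin \o (fun x => `|f x| - polyeval P2 x)).
      exact: integrable_sub_polyeval.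
    have mean0 : \int[mu]_(x in Q) (`|f x| - polyeval P2 x) = 0.
      rewrite -[RHS](P2P.2 mnm0) ?mdeg0//; apply: eq_Rintegral => x _.
      by rewrite /monomial big1 ?mulr1// => i _; rewrite mnm0E expr0.
    have -> : \int[mu]_(x in Q) `| `|f x| - f x| =
      \int[mu]_(x in Q) (polyeval P2 x - f x).
      rewrite -[RHS]add0r -mean0 -RintegralD//; apply: eq_Rintegral => x _.
      by rewrite ger0_norm ?negE ?mulr_ge0// -negE; ring.
    apply: le_Rintegral => //; first exact: (integrable_norm fP2).
    by move=> x _; rewrite -normrN opprB ler_norm.
  (* The 2 lost in [mean1_le] cancels that in [2 * A <= B], so [N <= H] holds with constant 1. *)
  rewrite -(@lee_pmul2l _ 2%:E)//; apply: le_trans mean1H.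
  by rewrite -AN -BE -EFinM lee_fin.
Qed.

End cube_comparison.

(** * Local integrability and membership in the spaces *)

Section membership.
Context (R : realType) (n : nat).
Implicit Types (f : euclid R n -> R) (Q X E : set (euclid R n)) (p q : \bar R).
Notation mu := (@lebesgue R n).

Lemma Lqloc_integrable q X f E : (1 <= q)%E -> measurable X -> Lqloc q X f ->
  measurable E -> bounded_set E -> E `<=` X -> mu.-integrable E (EFin \o f).
Proof.
move=> q1 mX [mf fin] mE bE EX; apply: (finite_norm_integrable q1) => //.
- apply: lt_le_trans (box_measure_gt0 0 (ltr01 : 0 < 1 :> R)) _.
  exact: lebesgue_outer_le.
- exact: bounded_measure_lty.
- exact: (measurable_funS mX EX mf).
- exact: fin.
Qed.

(** Membership of [f^-] in [RM p 1] includes local integrability with exponent 1, which has to be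
    drawn from that of [f] with exponent [q]. *)
Lemma Lqloc1_funrneg q X f : (1 <= q)%E -> measurable X -> Lqloc q X f ->
  Lqloc 1%E X f^\-.
Proof.
move=> q1 mX fX; have [mf _] := fX; split; first exact: measurable_funrneg.
move=> E mE bE EX; apply: (@integrable_finite_norm1 _ _ _ mu E f) => //.
- exact: (measurable_funS mX EX (measurable_funrneg mf)).
- exact: (Lqloc_integrable q1 mX fX).
- move=> x; rewrite ger0_norm// /funrneg ge_max normr_ge0 andbT.
  by rewrite -normrN ler_norm.
Qed.

Lemma measurable_domain X : X = setT \/ cube X -> measurable X.
Proof. by case=> [->|/measurable_cube]. Qed.

Lemma qmean_ge0 q Q f : (1 <= q)%E -> cube Q -> (0 <= qmean q Q f)%E.
Proof.
move=> q1 cQ; apply: (@mean_ge0 _ _ _ mu q Q f) => //.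
- exact: measurable_cube.
- exact: cube_measure_gt0.
Qed.

Lemma JNnorm_ge0 p q s alpha X f : (1 <= p)%E -> (1 <= q)%E ->
  X = setT \/ cube X -> (0 <= JNnorm p q s alpha X f)%E.
Proof. by move=> p1 q1 XX; apply: Nnorm_ge0 => // Q cQ _; exact: qmean_ge0. Qed.

Lemma RMnorm_ge0 p q alpha X f : (1 <= p)%E -> (1 <= q)%E ->
  X = setT \/ cube X -> (0 <= RMnorm p q alpha X f)%E.
Proof. by move=> p1 q1 XX; apply: Nnorm_ge0 => // Q cQ _; exact: qmean_ge0. Qed.

End membership.

Lemma norm_comparison (R : realType) (n s : nat) :
  exists c1 c2 : R, (0 < c1)%R /\ (0 < c2)%R /\
    forall (p q : \bar R) (alpha : R) (X : set (euclid R n)),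
      (1 <= p -> 1 <= q -> X = setT \/ cube X ->
      forall f : euclid R n -> R, Lqloc q X f ->
        c1%:E * (JNnorm p q s alpha X f + RMnorm p 1 alpha X (f^\-)%R)
          <= tJNnorm p q s alpha X f /\
        tJNnorm p q s alpha X f
          <= c2%:E * (JNnorm p q s alpha X f + RMnorm p 1 alpha X (f^\-)%R))%E.
Proof.
have [K K0 KP] := cube_comparison R n s.
have d0 : 0 < 16 * (K + 1) by lra.
(* [K + 1] is positive and at least 1, so it also serves for [N <= H]. Each of the two norms in the
   lower bound is at most [8 * (K + 1)] times [tJNnorm], whence 16. *)
exists (16 * (K + 1))^-1, (4 * (K + 1)); split; first by rewrite invr_gt0.
split; first lra.
move=> p q alpha X p1 q1 XX f fX.
have mX := measurable_domain XX.
have cmp Q : cube Q -> Q `<=` X -> _ := fun cQ QX => KP q Q f q1 cQ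
  (Lqloc_integrable q1 mX fX (measurable_cube cQ) (bounded_cube cQ) QX).
have K1 : 0 <= K + 1 by lra.
pose gJ Q := qmean q Q (fun x => f x - polyeval (polyproj s Q f) x).
pose gT Q := qmean q Q (fun x => f x - polyeval (polyproj s Q (fun y => `|f y|)) x).
pose gR Q := qmean 1%E Q f^\-.
rewrite -[JNnorm p q s alpha X f]/(Nnorm p alpha X gJ).
rewrite -[tJNnorm p q s alpha X f]/(Nnorm p alpha X gT).
rewrite -[RMnorm p 1%E alpha X f^\-]/(Nnorm p alpha X gR).
have J0 Q : cube Q -> Q `<=` X -> (0 <= gJ Q)%E by move=> cQ _; exact: qmean_ge0.
have T0 Q : cube Q -> Q `<=` X -> (0 <= gT Q)%E by move=> cQ _; exact: qmean_ge0.
have R0 Q : cube Q -> Q `<=` X -> (0 <= gR Q)%E by move=> cQ _;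
  exact: (@qmean_ge0 R n 1%E).
have KK (x : \bar R) : (0 <= x -> K%:E * x <= (K + 1)%:E * x)%E.
  by move=> x0; apply: lee_wpmul2r => //; rewrite lee_fin; lra.
have K1x (x : \bar R) : (0 <= x -> x <= (K + 1)%:E * x)%E.
  by move=> x0; rewrite lee_pemull// lee_fin; lra.
have xx (x : \bar R) : (0 <= x -> x <= x + x)%E by move=> x0; rewrite leeDl.
have TN0 := Nnorm_ge0 alpha p1 XX T0.
split; last first.
  apply: Nnorm_le_add => // Q cQ QX; have [cT cJ cR] := cmp Q cQ QX.
  by split; [exact: T0|exact: J0|exact: R0|]; apply: le_trans cT _; apply: KK;
    rewrite adde_ge0 ?J0 ?R0.
(* A one-term comparison obtained from the two-term [Nnorm_le_add] by using [gT] twice. *)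
have leT g : (forall Q, cube Q -> Q `<=` X -> 0 <= g Q)%E ->
    (forall Q, cube Q -> Q `<=` X -> g Q <= (K + 1)%:E * gT Q)%E ->
    (Nnorm p alpha X g <=
      (4 * (K + 1))%:E * (Nnorm p alpha X gT + Nnorm p alpha X gT))%E.
  move=> g0 gT_le; apply: Nnorm_le_add => // Q cQ QX.
  split; [exact: g0|exact: T0|exact: T0|].
  apply: le_trans (gT_le Q cQ QX) _.
  by apply: lee_wpmul2l; [rewrite lee_fin|apply: xx; exact: T0].
have hJ Q : cube Q -> Q `<=` X -> (gJ Q <= (K + 1)%:E * gT Q)%E.
  by move=> cQ QX; have [_ cJ _] := cmp Q cQ QX;
    exact: le_trans cJ (KK _ (T0 Q cQ QX)).
have hR Q : cube Q -> Q `<=` X -> (gR Q <= (K + 1)%:E * gT Q)%E.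
  by move=> cQ QX; have [_ _ cR] := cmp Q cQ QX;
    exact: le_trans cR (K1x _ (T0 Q cQ QX)).
rewrite lee_pdivrMl//; apply: le_trans (leeD (leT gJ J0 hJ) (leT gR R0 hR)) _.
move: TN0; move: (Nnorm p alpha X gT) => N TN0.
rewrite (_ : 16 * (K + 1) = 4 * (K + 1) * 2 + 4 * (K + 1) * 2); last ring.
have -> : (N + N = 2%:E * N)%E by rewrite mule_natl mule2n.
by rewrite muleA -!EFinM [in leRHS]EFinD ge0_muleDl ?lee_fin ?mulr_ge0.
Qed.

Local Open Scope ereal_scope.

Theorem theorem2p9 (R : realType) (n s : nat) :
  (forall (p q : \bar R) (alpha : R) (X : set (euclid R n)),
     1 <= p -> 1 <= q -> X = setT \/ cube X ->
     forall f : euclid R n -> R,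
       tJN p q s alpha X f <-> JN p q s alpha X f /\ RM p 1 alpha X (f^\-)%R) /\
  exists c1 c2 : R, (0 < c1)%R /\ (0 < c2)%R /\
    forall (p q : \bar R) (alpha : R) (X : set (euclid R n)),
      1 <= p -> 1 <= q -> X = setT \/ cube X ->
      forall f : euclid R n -> R, Lqloc q X f ->
        c1%:E * (JNnorm p q s alpha X f + RMnorm p 1 alpha X (f^\-)%R)
          <= tJNnorm p q s alpha X f /\
        tJNnorm p q s alpha X f
          <= c2%:E * (JNnorm p q s alpha X f + RMnorm p 1 alpha X (f^\-)%R).
Proof.
split; last exact: norm_comparison.
have [c1 [c2 [c10 [c20 cmp]]]] := norm_comparison R n s.
move=> p q alpha X p1 q1 XX f; have mX := measurable_domain XX.
have J0 := JNnorm_ge0 s alpha f p1 q1 XX.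
have N0 := RMnorm_ge0 alpha (f^\-)%R p1 (lexx 1) XX.
split=> [[fX Too]|[[fX Joo] [_ Noo]]]; have [lo up] := cmp p q alpha X p1 q1 XX f fX.
  have JNoo : JNnorm p q s alpha X f + RMnorm p 1 alpha X (f^\-)%R < +oo.
    rewrite -lee_pdivlMl// in lo; apply: le_lt_trans lo _.
    by rewrite lte_mul_pinfty ?lee_fin ?invr_ge0 ?(ltW c10).
  (* Both norms are nonnegative, so each is bounded by their finite sum. *)
  have Joo := le_lt_trans (leeDl _ N0) JNoo; have Noo := le_lt_trans (leeDr _ J0) JNoo.
  exact: (conj (conj fX Joo) (conj (Lqloc1_funrneg q1 mX fX) Noo)).
split; first exact: fX.
apply: le_lt_trans up _; rewrite lte_mul_pinfty ?lee_fin ?(ltW c20)//.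
exact: lte_add_pinfty.
Qed.
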